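(* Let $I=(I_-,I_+)\subset\mathbb R$ be a nonempty open interval with closure $\overline I=[I_-,I_+]\subset[-\infty,\infty]$, and let $\lambda_\pm:\overline I\to[0,\infty)$ be continuous functions such that $\lambda_-$ is nonincreasing, $\lambda_+$ is nondecreasing, and $\lambda_-,\lambda_+>0$ on $I$. Assume that the Stigler-Luckock model with demand and supply functions $\lambda_-,\lambda_+$ has an invariant law on $\mathcal S_{\rm ord}$ and let $(X_k)_{k\ge 0}$ denote the corresponding stationary process. Then the functions $f_\pm:\overline I\to\mathbb R$ defined by $$f_-(x):=\mathbb P\big[M_-(X_k)\le x\big]\quad\text{and}\quad f_+(x):=\mathbb P\big[M_+(X_k)\ge x\big]\qquad(x\in\overline I)$$ are continuous and solve the equations $$\text{(i)}\ \ f_-\,\mathrm d\lambda_++\lambda_-\,\mathrm df_+=0,\qquad \text{(ii)}\ \ f_+\,\mathrm d\lambda_-+\lambda_+\,\mathrm df_-=0,\qquad \text{(iii)}\ \ f_-(I_+)=1=f_+(I_-).$$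
   Context: **Measures.** If $f:\overline I\to\mathbb R$ is continuous and of bounded variation, $\mathrm df$ denotes the signed measure on $\overline I$ (without atoms) with $\mathrm df((x,y])=f(y)-f(x)$; for bounded measurable $g$, $g\,\mathrm df$ denotes the measure $\mathrm df$ weighted with the density $g$. Equations (i), (ii) are equalities of signed measures on $\overline I$. **Stigler-Luckock model.** Let $\mu_\pm$ be the finite measures on $\overline I$ with $\mu_-([x,I_+])=\lambda_-(x)$ and $\mu_+([I_-,x])=\lambda_+(x)$ for $x\in\overline I$. Let $\mu$ be the finite measure on $\overline I\times\{-,+\}$ with $\mu(A\times\{\sigma\})=\mu_\sigma(A)$, let $|\mu|$ be its total mass (assumed nonzero), and $\overline\mu:=|\mu|^{-1}\mu$. A counting measure is a finite or countable sum of delta measures. $\mathcal S_{\rm ord}$ is the set of all $\mathcal X=\mathcal X^+-\mathcal X^-$, where $\mathcal X^\pm$ are counting measures on $I$ such that: there are no $x\le y$ in $I$ with $\mathcal X^+(\{x\})>0$ and $\mathcal X^-(\{y\})>0$; and $\mathcal X^-((x,I_+))<\infty$ and $\mathcal X^+((I_-,x))<\infty$ for all $x\in I$. It is equipped with the $\sigma$-algebra generated by the maps $\mathcal X\mapsto\mathcal X^\pm(A)$, $A\subset I$ measurable. Put $$M_-(\mathcal X):=\max(\{I_-\}\cup\{x\in I:\mathcal X(\{x\})<0\}),\quad M_+(\mathcal X):=\min(\{I_+\}\cup\{x\in I:\mathcal X(\{x\})>0\}).$$ For $(u,\sigma)\in\overline I\times\{-,+\}$ the Luckock map $L_{u,\sigma}:\mathcal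 S_{\rm ord}\to\mathcal S_{\rm ord}$ is: $L_{u,-}(\mathcal X)=\mathcal X-\delta_{u\wedge M_+(\mathcal X)}$ if $u\wedge M_+(\mathcal X)\in I$; $L_{u,+}(\mathcal X)=\mathcal X+\delta_{u\vee M_-(\mathcal X)}$ if $u\vee M_-(\mathcal X)\in I$; and $L_{u,\sigma}(\mathcal X)=\mathcal X$ otherwise. The (discrete-time) Stigler-Luckock model is the Markov chain $X_k:=L_{U_k,\sigma_k}(X_{k-1})$ $(k\ge1)$, where $(U_k,\sigma_k)_{k\ge1}$ are i.i.d. with law $\overline\mu$, independent of $X_0$. An invariant law is a probability law $\nu$ on $\mathcal S_{\rm ord}$ such that $X_0\sim\nu$ implies $X_1\sim\nu$. *)

(* Defs.v *)
From HB Require Import structures.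
From mathcomp Require Import all_boot all_order all_algebra finmap.
From mathcomp Require Import all_classical all_reals all_analysis measurable_realfun.

Set Implicit Arguments.
Unset Strict Implicit.
Unset Printing Implicit Defensive.

Import Order.TTheory GRing.Theory Num.Theory.
Import numFieldNormedType.Exports.

Local Open Scope classical_set_scope.
Local Open Scope ring_scope.
Local Open Scope ereal_scope.

(* All sets and measures live on \bar R.  The points of the open interval
   strictly between Im and Ip are automatically finite, so [Iopen Im Ip] is an
   interval of real numbers; [Iclosed Im Ip] is its closure in [-oo, +oo]. *)
Definition Iopen (R : realType) (Im Ip : \bar R) : set (\bar R) :=
  [set x | Im < x < Ip].

Definition Iclosed (R : realType) (Im Ip : \bar R) : set (\bar R) :=
  [set x | Im <= x <= Ip].

(* Both sides are functions on all subsets of \bar R (the Dirac masses are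
   total), so a counting measure is determined by its atoms. *)
Definition counting_on (R : realType) (I : set (\bar R))
    (m : set (\bar R) -> \bar R) : Prop :=
  exists (D : set nat) (s : nat -> \bar R),
    (forall k, D k -> I (s k)) /\
    m = (fun A => \esum_(k in D) \d_(s k) A).

(* The pair p = (p.1, p.2) stands for the signed measure p.1 - p.2, which may be
   oo - oo on large sets but is well defined on compact subsets of I.  As p.1
   and p.2 have no common atom, p is its Jordan decomposition and is determined
   by it. *)
Definition ordered_pair (R : realType) (Im Ip : \bar R)
    (p : (set (\bar R) -> \bar R) * (set (\bar R) -> \bar R)) : Prop :=
  [/\ counting_on (Iopen Im Ip) p.1,
      counting_on (Iopen Im Ip) p.2,
      (forall x y, Iopen Im Ip x -> Iopen Im Ip y -> x <= y ->
         ~ (0 < p.1 [set x] /\ 0 < p.2 [set y])) &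
      (forall x, Iopen Im Ip x ->
         p.2 [set y | x < y < Ip] < +oo /\ p.1 [set y | Im < y < x] < +oo)].

Record order_book (R : realType) (Im Ip : \bar R) := OrderBook {
  book_pair : (set (\bar R) -> \bar R) * (set (\bar R) -> \bar R) ;
  book_pairP : ordered_pair Im Ip book_pair }.

(* Sell limit orders, the positive part of the signed measure. *)
Definition Xplus (R : realType) (Im Ip : \bar R) (X : order_book Im Ip) :=
  (book_pair X).1.

(* Buy limit orders, the negative part of the signed measure. *)
Definition Xminus (R : realType) (Im Ip : \bar R) (X : order_book Im Ip) :=
  (book_pair X).2.

Lemma ordered_pair0 (R : realType) (Im Ip : \bar R) :
  ordered_pair Im Ip (fun=> 0, fun=> 0).
Proof.
have c0 : counting_on (Iopen Im Ip) (fun=> 0).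
  exists set0, (fun=> 0); split => //.
  by apply/funext => A; rewrite esum_set0.
split => //=; first by move=> x y _ _ _ []; rewrite ltxx.
Qed.

HB.instance Definition _ (R : realType) (Im Ip : \bar R) :=
  gen_eqMixin (order_book Im Ip).
HB.instance Definition _ (R : realType) (Im Ip : \bar R) :=
  gen_choiceMixin (order_book Im Ip).
HB.instance Definition _ (R : realType) (Im Ip : \bar R) :=
  isPointed.Build (order_book Im Ip) (OrderBook (ordered_pair0 Im Ip)).

Definition book_gen (R : realType) (Im Ip : \bar R) :
    set (set (order_book Im Ip)) :=
  [set E | exists A B : set (\bar R),
    [/\ measurable A, A `<=` Iopen Im Ip, measurable B &
        E = [set X | B (Xplus X A)] \/ E = [set X | B (Xminus X A)]]].

Definition Sord (R : realType) (Im Ip : \bar R) :=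
  g_sigma_algebraType (@book_gen R Im Ip).

Definition atom (R : realType) (Im Ip : \bar R) (X : order_book Im Ip)
  (x : \bar R) : \bar R := Xplus X [set x] - Xminus X [set x].

Definition buy_points (R : realType) (Im Ip : \bar R) (X : order_book Im Ip) :
  set (\bar R) := [set Im] `|` [set x | Iopen Im Ip x /\ atom X x < 0].

Definition sell_points (R : realType) (Im Ip : \bar R) (X : order_book Im Ip) :
  set (\bar R) := [set Ip] `|` [set x | Iopen Im Ip x /\ 0 < atom X x].

(* The supremum and the infimum are attained, hence a maximum and a minimum:
   see [Mminus_max] and [Mplus_min] below. *)
Definition Mminus (R : realType) (Im Ip : \bar R) (X : order_book Im Ip) :
  \bar R := ereal_sup (buy_points X).

Definition Mplus (R : realType) (Im Ip : \bar R) (X : order_book Im Ip) :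
  \bar R := ereal_inf (sell_points X).

Section attained.
Variables (R : realType) (Im Ip : \bar R).
Implicit Types (X : order_book Im Ip) (m : set (\bar R) -> \bar R).

Lemma counting_ge0 m A : counting_on (Iopen Im Ip) m -> 0 <= m A.
Proof. by move=> [D [s [_ ->]]]; apply: esum_ge0. Qed.

Lemma counting_finite_atoms m A : counting_on (Iopen Im Ip) m -> m A < +oo ->
  finite_set [set x | A x /\ 0 < m [set x]].
Proof.
move=> [D [s [Ds ->]]] mA.
pose K := D `&` s @^-1` A.
have finK : finite_set K.
  apply: contrapT => infK; move: mA; suff -> : \esum_(k in D) \d_(s k) A = +oo :> \bar R.
    by rewrite ltxx.
  rewrite -(infinite_card_dirac R infK) esum_mkcond [RHS]esum_mkcond.
  apply: eq_esum => k _; rewrite !diracE.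
  have -> : (k \in K) = (k \in D) && (s k \in A).
    by rewrite in_setI; congr andb; apply/idP/idP => /set_mem h; exact/mem_set.
  by case: (k \in D) => //=; case: (s k \in A).
apply: (sub_finite_set _ (finite_image s finK)) => x [Ax] /=.
apply: contraPP => nx; apply/negP; rewrite -leNgt esum1// => k Dk.
rewrite diracE memNset//= => skx; apply: nx; exists k => //.
by split => //=; rewrite skx.
Qed.

Lemma finite_has_max (S : set (\bar R)) x0 : S x0 ->
  finite_set [set x | S x /\ x0 < x] -> S (ereal_sup S).
Proof.
move=> Sx0 finS.
have [z Sz zmax] : exists2 z, S z & ubound S z.
  suff [z Sz zmax] : exists2 z, S z /\ x0 <= z &
      forall y, S y /\ x0 < y -> y <= z.
    exists z; first by case: Sz.
    move=> y Sy; have [yx0|x0y] := leP y x0; first by case: Sz => _; exact: le_trans.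
    exact: zmax.
  have /finite_seqP[s Es] := finS.
  have {Es} : forall y, S y /\ x0 < y <-> y \in s.
    by move=> y; have := congr1 (fun A : set (\bar R) => A y) Es; rewrite /= => ->.
  move=> Es; have {Es} [Es1 Es2] : (forall y, y \in s -> S y /\ x0 < y) /\
      (forall y, S y /\ x0 < y -> y \in s) by split => y /Es.
  suff [z Sz zmax] : exists2 z, S z /\ x0 <= z & forall y, y \in s -> y <= z.
    by exists z => // y /Es2 /zmax.
  elim: s Es1 {Es2} => [|a s IH] Es1; first by exists x0.
  have [|z [Sz x0z] zmax] := IH; first by move=> y ys; apply: Es1; rewrite inE ys orbT.
  have [Sa x0a] := Es1 a (mem_head _ _).
  have [az|za] := leP a z.
    by exists z => // y; rewrite inE => /predU1P[->//|/zmax].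
  exists a; first by split => //; exact: ltW.
  move=> y; rewrite inE => /predU1P[->//|/zmax yz]; exact: le_trans yz (ltW za).
suff -> : ereal_sup S = z by [].
apply/eqP; rewrite eq_le ereal_sup_ubound// andbT; exact: ge_ereal_sup.
Qed.

Lemma atom_lt0 X x : atom X x < 0 -> 0 < Xminus X [set x].
Proof.
have [c1 c2 _ _] := book_pairP X; rewrite /atom /Xplus /Xminus.
have := counting_ge0 [set x] c1; have := counting_ge0 [set x] c2.
rewrite le_eqVlt => /predU1P[<-|//].
by rewrite sube0 => p0 /lt_geF; rewrite p0.
Qed.

Lemma atom_gt0 X x : 0 < atom X x -> 0 < Xplus X [set x].
Proof.
have [c1 c2 _ _] := book_pairP X; rewrite /atom /Xplus /Xminus.
have := counting_ge0 [set x] c2; have := counting_ge0 [set x] c1.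
rewrite le_eqVlt => /predU1P[<-|//].
by rewrite sub0e oppe_gt0 => p0 /lt_geF; rewrite p0.
Qed.

Lemma Mminus_max X : buy_points X (Mminus X).
Proof.
have [c1 c2 _ loc] := book_pairP X.
have [[x0 [Ix0 ax0]]|none] :=
  pselect (exists x, Iopen Im Ip x /\ atom X x < 0); last first.
  suff E : buy_points X = [set Im] by rewrite /Mminus E ereal_sup1.
  apply/seteqP; split => x; last by left.
  by case => // h; exfalso; apply: none; exists x.
apply: (@finite_has_max _ x0); first by right.
have [fin2 _] := loc _ Ix0.
apply: (sub_finite_set _ (counting_finite_atoms c2 fin2)) => x /= -[].
case=> [->|[/andP[_ xIp] ax]] x0x; last by rewrite x0x xIp; split => //; exact: atom_lt0.
by case/andP: Ix0 => /lt_trans /(_ x0x); rewrite ltxx.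
Qed.

Lemma Mplus_min X : sell_points X (Mplus X).
Proof.
have [c1 c2 _ loc] := book_pairP X.
suff : [set - x | x in sell_points X] (ereal_sup [set - x | x in sell_points X]).
  by move=> [x Sx E]; rewrite /Mplus /ereal_inf -E oppeK.
have [[x0 [Ix0 ax0]]|none] :=
  pselect (exists x, Iopen Im Ip x /\ 0 < atom X x); last first.
  suff -> : sell_points X = [set Ip] by rewrite image_set1 ereal_sup1.
  apply/seteqP; split => x; last by left.
  by case => // h; exfalso; apply: none; exists x.
apply: (@finite_has_max _ (- x0)); first by exists x0 => //; right.
have [_ fin1] := loc _ Ix0.
apply: (sub_finite_set _ (finite_image (@oppe R) (counting_finite_atoms c1 fin1))).
move=> _ /= [[x Sx <-]]; rewrite lteN2 => xx0; exists x => //.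
case: Sx => [E|[/andP[Imx _] ax]]; last by rewrite Imx xx0; split => //; exact: atom_gt0.
by move: xx0; rewrite E; case/andP: Ix0 => _ /lt_trans h /h; rewrite ltxx.
Qed.

Lemma counting_add m y : Iopen Im Ip y -> counting_on (Iopen Im Ip) m ->
  counting_on (Iopen Im Ip) (fun A => m A + \d_y A).
Proof.
move=> Iy [D [s [Ds ->]]].
exists ([set 0%N] `|` S @` D), (fun k => if k is k'.+1 then s k' else y); split.
  by move=> k [->//|[k' Dk' <-]]; exact: Ds.
apply/funext => A; rewrite [RHS](esumID [set 0%N]); last by move=> *; rewrite diracE.
have -> : ([set 0%N] `|` S @` D) `&` [set 0%N] = [set 0%N].
  by apply/seteqP; split => [k []//|k /= ->]; split => //; left.
have -> : ([set 0%N] `|` S @` D) `&` ~` [set 0%N] = S @` D.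
  apply/seteqP; split => [k [[]//]|k [k' Dk' <-]].
  by split => //; right; exists k'.
rewrite esum_set1 ?diracE// addeC; congr (_ + _).
by rewrite esum_image//; move=> k l _ _ [].
Qed.

Lemma counting_remove m y : counting_on (Iopen Im Ip) m -> 0 < m [set y] ->
  counting_on (Iopen Im Ip) (fun A => m A - \d_y A).
Proof.
move=> [D [s [Ds ->]]] my.
have [k0 Dk0 sk0] : exists2 k, D k & s k = y.
  apply: contrapT => no; move: my; rewrite esum1 ?ltxx// => k Dk.
  by rewrite diracE memNset//= => sk; apply: no; exists k.
exists (D `&` ~` [set k0]), s; split; first by move=> k [/Ds].
apply/funext => A; rewrite (esumID [set k0]); last by move=> *; rewrite diracE.
have -> : D `&` [set k0] = [set k0].
  by apply/seteqP; split => [k []//|k /= ->].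
by rewrite esum_set1 ?diracE// sk0 addeAC subee// add0e.
Qed.

End attained.

(* The Jordan decomposition of p.1 - p.2 + \d_y: an atom of p.2 at y loses one
   unit of mass, otherwise p.1 gains one. *)
Definition add_order (R : realType) (y : \bar R)
    (p : (set (\bar R) -> \bar R) * (set (\bar R) -> \bar R)) :=
  if `[< 0 < p.2 [set y] >] then (p.1, fun A => p.2 A - \d_y A)
  else (fun A => p.1 A + \d_y A, p.2).

(* The Jordan decomposition of p.1 - p.2 - \d_y. *)
Definition sub_order (R : realType) (y : \bar R)
    (p : (set (\bar R) -> \bar R) * (set (\bar R) -> \bar R)) :=
  if `[< 0 < p.1 [set y] >] then (fun A => p.1 A - \d_y A, p.2)
  else (p.1, fun A => p.2 A + \d_y A).

(* The side - is [false] and the side + is [true]. *)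
Definition order_price (R : realType) (Im Ip : \bar R) (w : \bar R * bool)
    (X : order_book Im Ip) : \bar R :=
  if w.2 then maxe w.1 (Mminus X) else mine w.1 (Mplus X).

Definition luckock_pair (R : realType) (Im Ip : \bar R) (w : \bar R * bool)
    (X : order_book Im Ip) :=
  let y := order_price w X in
  if `[< Iopen Im Ip y >] then
    if w.2 then add_order y (book_pair X) else sub_order y (book_pair X)
  else book_pair X.

Lemma luckock_pairP (R : realType) (Im Ip : \bar R) (w : \bar R * bool)
    (X : order_book Im Ip) : ordered_pair Im Ip (luckock_pair w X).
Proof.
have ordX := book_pairP X; have [c1 c2 ord loc] := ordX.
rewrite /luckock_pair; case: asboolP => // Iy.
have doo (z : \bar R) A : (\d_z A : \bar R) < +oo by rewrite diracE ltry.
have sub_le (m : set (\bar R) -> \bar R) (z : \bar R) A : m A - \d_z A <= m A.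
  by rewrite -[leRHS]adde0; apply: leeD => //; rewrite oppe_le0.
move: Iy; rewrite /order_price; case: w.2.
- set y := maxe _ _ => Iy.
  have My : Mminus X <= y by rewrite /y le_max lexx orbT.
  clearbody y.
  rewrite /add_order; case: asboolP => y2; split => //=.
  + exact: counting_remove.
  + move=> x z Ix Iz xz [x1 z2]; apply: (ord _ _ Ix Iz xz); split => //.
    exact: lt_le_trans z2 (sub_le (book_pair X).2 _ _).
  + by move=> x /loc[f2 f1]; split => //; exact: le_lt_trans (sub_le (book_pair X).2 _ _) f2.
  + exact: counting_add.
  + move=> x z Ix Iz xz [x1 z2].
    have [p1|np1] := pselect (0 < (book_pair X).1 [set x]).
      exact: (ord _ _ Ix Iz xz).
    have p10 : (book_pair X).1 [set x] = 0.
      apply/eqP; rewrite eq_le (counting_ge0 _ c1) andbT leNgt; exact/negP.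
    move: x1; rewrite p10 add0e diracE; case: (boolP (y \in [set x])) => [/set_mem yx _|_];
      last by rewrite ltxx.
    rewrite /= in yx; subst y.
    have z1 : (book_pair X).1 [set z] = 0.
      apply/eqP; rewrite eq_le (counting_ge0 _ c1) andbT leNgt; apply/negP => z1.
      exact: (ord _ _ Iz Iz (lexx z)).
    have zM : z <= Mminus X.
      apply: ereal_sup_ubound; right; split => //.
      by rewrite /atom /Xplus /Xminus z1 sub0e oppe_lt0.
    by apply: y2; rewrite (_ : x = z)//; apply/eqP; rewrite eq_le xz (le_trans zM My).
  + move=> x /loc[f2 f1]; split => //; exact: lte_add_pinfty.
- set y := mine _ _ => Iy.
  have My : y <= Mplus X by rewrite /y ge_min lexx orbT.
  clearbody y.
  rewrite /sub_order; case: asboolP => y1; split => //=.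
  + exact: counting_remove.
  + move=> x z Ix Iz xz [x1 z2]; apply: (ord _ _ Ix Iz xz); split => //.
    exact: lt_le_trans x1 (sub_le (book_pair X).1 _ _).
  + by move=> x /loc[f2 f1]; split => //; exact: le_lt_trans (sub_le (book_pair X).1 _ _) f1.
  + exact: counting_add.
  + move=> x z Ix Iz xz [x1 z2].
    have [p2|np2] := pselect (0 < (book_pair X).2 [set z]).
      exact: (ord _ _ Ix Iz xz).
    have p20 : (book_pair X).2 [set z] = 0.
      apply/eqP; rewrite eq_le (counting_ge0 _ c2) andbT leNgt; exact/negP.
    move: z2; rewrite p20 add0e diracE; case: (boolP (y \in [set z])) => [/set_mem yz _|_];
      last by rewrite ltxx.
    rewrite /= in yz; subst y.
    have x2 : (book_pair X).2 [set x] = 0.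
      apply/eqP; rewrite eq_le (counting_ge0 _ c2) andbT leNgt; apply/negP => x2.
      exact: (ord _ _ Ix Ix (lexx x)).
    have Mx : Mplus X <= x.
      apply: ereal_inf_lbound; right; split => //.
      by rewrite /atom /Xplus /Xminus x2 sube0.
    by apply: y1; rewrite (_ : z = x)//; apply/eqP; rewrite eq_le xz (le_trans My Mx).
  + move=> x /loc[f2 f1]; split => //; exact: lte_add_pinfty.
Qed.

Definition luckock (R : realType) (Im Ip : \bar R) (w : \bar R * bool)
    (X : Sord Im Ip) : Sord Im Ip := OrderBook (luckock_pairP w X).

(* mum, mup are the measures with distribution functions lm and lp, and mu
   puts them on the two sheets of Iclosed x {-,+}.  Being carried by
   Iclosed is expressed by giving mass 0 to the complement. *)
Definition demand_supply_measure (R : realType) (Im Ip : \bar R)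
    (lm lp : \bar R -> R)
    (mum mup : {finite_measure set (\bar R) -> \bar R})
    (mu : {finite_measure set (\bar R * bool)%type -> \bar R}) : Prop :=
  [/\ mum (~` Iclosed Im Ip) = 0 /\ mup (~` Iclosed Im Ip) = 0,
      (forall x, Iclosed Im Ip x -> mum [set u | x <= u <= Ip] = (lm x)%:E),
      (forall x, Iclosed Im Ip x -> mup [set u | Im <= u <= x] = (lp x)%:E) &
      (forall A, measurable A -> mu (A `*` [set false]) = mum A /\
                                 mu (A `*` [set true]) = mup A)].

Definition has_law d d' (Omega : measurableType d) (T : measurableType d')
    (R : realType) (P : probability Omega R) (X : {RV P >-> T})
    (m : set T -> \bar R) : Prop :=
  forall A, measurable A -> distribution P X A = m A.

Definition normalized d (T : measurableType d) (R : realType)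
    (mu : {finite_measure set T -> \bar R}) (A : set T) : \bar R :=
  ((fine (mu setT))^-1)%:E * mu A.

(* The input W k is the pair (U_(k+1), sigma_(k+1)) of the (k+1)-st step. *)
Definition stigler_luckock (R : realType) (Im Ip : \bar R)
    (mu : {finite_measure set (\bar R * bool)%type -> \bar R})
    d (Omega : measurableType d) (P : probability Omega R)
    (X : nat -> {RV P >-> Sord Im Ip})
    (W : nat -> {RV P >-> (\bar R * bool)%type}) : Prop :=
  [/\ (forall k, has_law (W k) (normalized mu)),
      (forall (A : set (Sord Im Ip)) (J : {fset nat})
              (B : nat -> set (\bar R * bool)%type),
         measurable A -> (forall k, measurable (B k)) ->
         P (X 0%N @^-1` A `&` \bigcap_(k in [set` J]) (W k @^-1` B k)) =
         P (X 0%N @^-1` A) * \prod_(k <- J) P (W k @^-1` B k)) &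
      (forall k w, X k.+1 w = luckock (W k w) (X k w))].

Definition invariant_law (R : realType) (Im Ip : \bar R)
    (mu : {finite_measure set (\bar R * bool)%type -> \bar R})
    (nu : probability (Sord Im Ip) R) : Prop :=
  forall d (Omega : measurableType d) (P : probability Omega R)
    (X : nat -> {RV P >-> Sord Im Ip})
    (W : nat -> {RV P >-> (\bar R * bool)%type}),
    stigler_luckock mu X W -> has_law (X 0%N) nu -> has_law (X 1%N) nu.

(* [nu] is df: at most one charge has these properties. *)
Definition is_differential (R : realType) (Im Ip : \bar R) (f : \bar R -> R)
    (nu : {charge set (\bar R) -> \bar R}) : Prop :=
  [/\ (forall A, measurable A -> A `<=` ~` Iclosed Im Ip -> nu A = 0),
      (forall x, nu [set x] = 0) &
      (forall x y, Iclosed Im Ip x -> Iclosed Im Ip y -> x <= y ->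
         nu [set z | x < z <= y] = (f y - f x)%:E)].

(* The signed measure g nu, written with the Jordan decomposition of nu. *)
Definition weighted (R : realType) (g : \bar R -> R)
    (nu : {charge set (\bar R) -> \bar R}) (A : set (\bar R)) : \bar R :=
  let nuPN := projT2 (cid (projT2 (cid (Hahn_decomposition nu)))) in
  \int[jordan_pos nuPN]_(x in A) (g x)%:E
  - \int[jordan_neg nuPN]_(x in A) (g x)%:E.

(* Main.v *)
Require Import Defs.
From HB Require Import structures.
From mathcomp Require Import all_boot all_order all_algebra finmap.
From mathcomp Require Import all_classical all_reals all_analysis measurable_realfun.
From mathcomp Require Import ring lra.

(* Let A be a Borel set bounded away from Ip inside I.  A step raises the number
   of sell orders in A by one when a seller arrives at a price u in A with
   u > M_-, and lowers it by one when M_+ is in A and a buyer arrives at a price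
   u >= M_+.  This number is finite and has the same law before and after the
   step, so both events are equally likely, whether or not it is integrable.  As
   the arriving order is independent of the book, Fubini's theorem turns the
   equality into
     int_A P[M_- < u] mu_+(du) = int_A lambda_-(y) P[M_+ in dy],
   and monotone limits extend it to every Borel subset A of I.  Taking A = {x}
   shows that M_+ has no atom in I, because mu_+ has none and lambda_- > 0; this
   makes f_+ continuous, and likewise f_-, so that P[M_- < u] = f_-(u) and the
   equality becomes (i).  Exchanging buyers and sellers gives (ii). *)

Set Implicit Arguments.
Unset Strict Implicit.
Unset Printing Implicit Defensive.

Import Order.TTheory GRing.Theory Num.Theory.
Import numFieldNormedType.Exports.

Local Open Scope classical_set_scope.
Local Open Scope ring_scope.
Local Open Scope ereal_scope.

(** * One step of the order book *)

(** The endpoints need separate care. [M_-] may equal $I_-$ with positive probability and $\mu_+$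
    may charge $I_-$, and dually at $I_+$. Such atoms shift $f_-$ and $\lambda_+$ by constants and
    leave their differentials unchanged. Each differential is therefore realised as plus or minus
    the restriction to $I$ of a finite measure, $\mu_\pm$ or the law of $M_\pm$, and (i), (ii)
    become equalities of integrals over $A\cap I$. At the opposite ends, $M_-<I_+$ and $M_+>I_-$
    hold for every book, which gives (iii) and the continuity there. Independence is assumed between
    $X_0$ and the inputs. For $X_k$ and the next order it is proved by an induction that carries all
    later inputs along. *)

Section order_book_dynamics.
Context (R : realType) (Im Ip : \bar R).
Implicit Types (X : order_book Im Ip) (w : \bar R * bool) (A : set (\bar R)).

Lemma dirac_le_counting (m : set (\bar R) -> \bar R) (D : set nat) s k A :
  m = (fun A => \esum_(k in D) \d_(s k) A) -> D k -> \d_(s k) A <= m A.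
Proof.
move=> -> Dk; rewrite (esumID [set k])//.
have -> : D `&` [set k] = [set k] by apply/seteqP; split => [j []//|j ->].
by rewrite esum_set1// leeDl// esum_ge0.
Qed.

(** Being a sum of Dirac masses, a counting measure that charges a set charges one of its points.
    This links best prices, defined by atoms, to the masses of sets that generate the sigma-algebra
    of [Sord]. *)
Lemma counting_eq0P (m : set (\bar R) -> \bar R) A :
  counting_on (Iopen Im Ip) m ->
  m A = 0 <-> forall x, A x -> m [set x] = 0.
Proof.
move=> [D [s [Ds mE]]]; split => [A0 x Ax|A0].
  rewrite mE; apply: esum1 => k Dk; rewrite diracE.
  case: (boolP (s k \in _)) => // /set_mem/= skx.
  have := dirac_le_counting A mE Dk.
  by rewrite A0 diracE skx mem_set// lee_fin ler10.
rewrite mE; apply: esum1 => k Dk; rewrite diracE.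
case: (boolP (s k \in A)) => // /set_mem As.
have := dirac_le_counting [set s k] mE Dk.
by rewrite A0// diracE mem_set// lee_fin ler10.
Qed.

Lemma Xplus_ge0 X A : 0 <= Xplus X A.
Proof. by have [c1 _ _ _] := book_pairP X; exact: counting_ge0 c1. Qed.

Lemma Xminus_ge0 X A : 0 <= Xminus X A.
Proof. by have [_ c2 _ _] := book_pairP X; exact: counting_ge0 c2. Qed.

(** The order condition taken at two equal prices forbids a buy and a sell order at the same point,
    so nothing cancels in [atom]. *)
Lemma buy_pointsP X x : Iopen Im Ip x ->
  buy_points X x <-> 0 < Xminus X [set x].
Proof.
move=> Ix; split => [[xE|[_ /atom_lt0//]]|x0].
  by move: Ix; rewrite xE /Iopen/= ltxx.
right; split => //; rewrite /atom.
suff -> : Xplus X [set x] = 0 by rewrite sub0e oppe_lt0.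
apply/eqP; rewrite eq_le Xplus_ge0 andbT leNgt; apply/negP => p0.
by have [_ _ /(_ _ _ Ix Ix (lexx x)) + _] := book_pairP X; apply; split.
Qed.

Lemma sell_pointsP X x : Iopen Im Ip x ->
  sell_points X x <-> 0 < Xplus X [set x].
Proof.
move=> Ix; split => [[xE|[_ /atom_gt0//]]|x0].
  by move: Ix; rewrite xE /Iopen/= ltxx andbF.
right; split => //; rewrite /atom.
suff -> : Xminus X [set x] = 0 by rewrite sube0.
apply/eqP; rewrite eq_le Xminus_ge0 andbT leNgt; apply/negP => p0.
by have [_ _ /(_ _ _ Ix Ix (lexx x)) + _] := book_pairP X; apply; split.
Qed.

Lemma atom_le_Mminus X x : Iopen Im Ip x -> 0 < Xminus X [set x] ->
  x <= Mminus X.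
Proof. by move=> Ix /(buy_pointsP X Ix); exact: ereal_sup_ubound. Qed.

Lemma Mplus_le_atom X x : Iopen Im Ip x -> 0 < Xplus X [set x] ->
  Mplus X <= x.
Proof. by move=> Ix /(sell_pointsP X Ix); exact: ereal_inf_lbound. Qed.

Lemma Mminus_atom X : Iopen Im Ip (Mminus X) -> 0 < Xminus X [set Mminus X].
Proof. by move=> IM; apply/(buy_pointsP X IM)/Mminus_max. Qed.

Lemma Mplus_atom X : Iopen Im Ip (Mplus X) -> 0 < Xplus X [set Mplus X].
Proof. by move=> IM; apply/(sell_pointsP X IM)/Mplus_min. Qed.

(** The four events live on the product of orders and books, where Fubini applies. An order whose
    price equals the best opposite price is executed, hence strict inequalities for additions and
    weak ones for removals. A removal takes place at the best price, so there [A] constrains that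
    price and not the arriving one. *)
Definition sell_added A : set ((\bar R * bool) * Sord Im Ip) :=
  [set z | [/\ z.1.2 = true, A z.1.1 & Mminus z.2 < z.1.1]].

Definition sell_removed A : set ((\bar R * bool) * Sord Im Ip) :=
  [set z | [/\ z.1.2 = false, A (Mplus z.2) & Mplus z.2 <= z.1.1]].

Definition buy_added A : set ((\bar R * bool) * Sord Im Ip) :=
  [set z | [/\ z.1.2 = false, A z.1.1 & z.1.1 < Mplus z.2]].

Definition buy_removed A : set ((\bar R * bool) * Sord Im Ip) :=
  [set z | [/\ z.1.2 = true, A (Mminus z.2) & z.1.1 <= Mminus z.2]].

Lemma Xplus_luckock w X A : A `<=` Iopen Im Ip ->
  Xplus (luckock w X) A = Xplus X A
    + (\1_(sell_added A) (w, X))%:E - (\1_(sell_removed A) (w, X))%:E.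
Proof.
move=> AI; rewrite /Xplus/= /luckock_pair.
rewrite /order_price; case: w => u [] /=; rewrite !indicE.
- rewrite (memNset (A := sell_removed A)) ?sube0; last by case.
  case: asboolP => Iy; last first.
    rewrite memNset ?adde0// => -[_ /= Au Mu]; apply: Iy.
    by rewrite (max_l (ltW Mu)); exact: AI.
  (* If a buy order sits at the execution price, that price is at most [Mminus X], so the incoming
     sell order is matched and cannot be added. *)
  rewrite /add_order; case: asboolP => /= y0.
    rewrite memNset ?adde0// => -[_ /= Au Mu].
    by have := atom_le_Mminus Iy y0; rewrite (max_l (ltW Mu)) leNgt Mu.
  (* Otherwise the execution price would be [Mminus X], a point of $I$, which does carry a buy
     order. *)
  have Mu : Mminus X < u.
    rewrite ltNge; apply/negP => uM; move: y0 Iy; rewrite max_r// => y0 Iy.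
    exact/y0/Mminus_atom.
  rewrite (max_l (ltW Mu)) diracE; congr (_ + (nat_of_bool _)%:R%:E).
  apply/idP/idP => /set_mem; first by move=> Au; exact/mem_set.
  by move=> [_ Au _]; exact/mem_set.
- rewrite (memNset (A := sell_added A)) ?adde0; last by case.
  case: asboolP => Iy; last first.
    rewrite memNset ?sube0// => -[_ /= Au Mu]; apply: Iy.
    by rewrite min_r//; exact: AI.
  rewrite /sub_order; case: asboolP => /= y0; last first.
    rewrite memNset ?sube0// => -[_ /= Au Mu].
    by move: y0 Iy; rewrite min_r// => y0 Iy; exact/y0/Mplus_atom.
  have Mu : Mplus X <= u.
    rewrite leNgt; apply/negP => uM; move: y0 Iy; rewrite (min_l (ltW uM)) => y0 Iy.
    by have := Mplus_le_atom Iy y0; rewrite leNgt uM.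
  rewrite min_r// indicE; congr (_ + (- (nat_of_bool _)%:R)%:E).
  apply/idP/idP => /set_mem; first by move=> Au; exact/mem_set.
  by move=> [_ Au _]; exact/mem_set.
Qed.

Lemma Xminus_luckock w X A : A `<=` Iopen Im Ip ->
  Xminus (luckock w X) A = Xminus X A
    + (\1_(buy_added A) (w, X))%:E - (\1_(buy_removed A) (w, X))%:E.
Proof.
move=> AI; rewrite /Xminus/= /luckock_pair.
rewrite /order_price; case: w => u [] /=; rewrite !indicE.
- rewrite (memNset (A := buy_added A)) ?adde0; last by case.
  case: asboolP => Iy; last first.
    rewrite memNset ?sube0// => -[_ /= Au Mu]; apply: Iy.
    by rewrite max_r//; exact: AI.
  rewrite /add_order; case: asboolP => /= y0; last first.
    rewrite memNset ?sube0// => -[_ /= Au Mu].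
    by move: y0 Iy; rewrite max_r// => y0 Iy; exact/y0/Mminus_atom.
  have Mu : u <= Mminus X.
    rewrite leNgt; apply/negP => uM; move: y0 Iy; rewrite (max_l (ltW uM)) => y0 Iy.
    by have := atom_le_Mminus Iy y0; rewrite leNgt uM.
  rewrite max_r// indicE; congr (_ + (- (nat_of_bool _)%:R)%:E).
  apply/idP/idP => /set_mem; first by move=> Au; exact/mem_set.
  by move=> [_ Au _]; exact/mem_set.
- rewrite (memNset (A := buy_removed A)) ?sube0; last by case.
  case: asboolP => Iy; last first.
    rewrite memNset ?adde0// => -[_ /= Au Mu]; apply: Iy.
    by rewrite (min_l (ltW Mu)); exact: AI.
  rewrite /sub_order; case: asboolP => /= y0.
    rewrite memNset ?adde0// => -[_ /= Au Mu].
    by have := Mplus_le_atom Iy y0; rewrite (min_l (ltW Mu)) leNgt Mu.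
  have Mu : u < Mplus X.
    rewrite ltNge; apply/negP => uM; move: y0 Iy; rewrite min_r// => y0 Iy.
    exact/y0/Mplus_atom.
  rewrite (min_l (ltW Mu)) diracE; congr (_ + (nat_of_bool _)%:R%:E).
  apply/idP/idP => /set_mem; first by move=> Au; exact/mem_set.
  by move=> [_ Au _]; exact/mem_set.
Qed.

End order_book_dynamics.

(** * Measurability *)

(** [contract] is an order isomorphism of [\bar R] onto $[-1,1]$, so it reduces comparisons of
    extended-real functions to comparisons of real ones. Levels outside $[-1,1]$ are treated apart
    because [expand] inverts [contract] only on that interval. *)
Lemma measurable_contract (R : realType) :
  measurable_fun [set: \bar R] (@contract R).
Proof.
move=> _; apply: (measurability _ (RGenOInfty.measurableE R)) => //.
move=> _ [_ [r ->] <-]; rewrite setTI.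
have [r1|r1] := leP r 1%R; last first.
  rewrite (_ : _ @^-1` _ = set0)//; apply/seteqP; split => // x /=.
  rewrite in_itv/= andbT => rx; have /ler_normlP[_] := contract_le1 x.
  by rewrite leNgt (lt_trans r1 rx).
have [rN1|rN1] := leP (-1)%R r; last first.
  rewrite (_ : _ @^-1` _ = setT)//; apply/seteqP; split => // x _ /=.
  rewrite in_itv/= andbT (lt_le_trans rN1)//.
  by have /ler_normlP[] := contract_le1 x; rewrite lerNl.
rewrite (_ : _ @^-1` _ = `]expand r, +oo[%classic).
  exact: emeasurable_itv.
apply/seteqP; split => x /=; rewrite !in_itv/= !andbT lt_expandLR//;
  by rewrite inE ler_norml rN1.
Qed.

Section emeasurable_order.
Context d (T : measurableType d) (R : realType).
Variables (f g : T -> \bar R).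
Hypotheses (mf : measurable_fun [set: T] f) (mg : measurable_fun [set: T] g).

Lemma emeasurable_lt : measurable [set x | f x < g x].
Proof.
have := measurable_fun_ltr (measurableT_comp (@measurable_contract R) mf)
  (measurableT_comp (@measurable_contract R) mg).
move=> /(_ measurableT [set true] Logic.I); rewrite setTI.
congr (_ _); apply/seteqP; split => x /=; by rewrite lt_contract.
Qed.

Lemma emeasurable_le : measurable [set x | f x <= g x].
Proof.
have := measurable_fun_ler (measurableT_comp (@measurable_contract R) mf)
  (measurableT_comp (@measurable_contract R) mg).
move=> /(_ measurableT [set true] Logic.I); rewrite setTI.
congr (_ _); apply/seteqP; split => x /=; by rewrite le_contract.
Qed.

End emeasurable_order.

Section order_book_measurability.
Context (R : realType) (Im Ip : \bar R).
Implicit Types A : set (\bar R).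
Local Notation Sord := (@Sord R Im Ip).

Lemma measurable_Iopen : measurable (Iopen Im Ip).
Proof.
rewrite (_ : Iopen _ _ = `]Im, Ip[%classic); first exact: emeasurable_itv.
by apply/seteqP; split => x; rewrite /= in_itv.
Qed.

Lemma measurable_Xplus A : measurable A -> A `<=` Iopen Im Ip ->
  measurable_fun setT (fun X : Sord => Xplus X A).
Proof.
move=> mA AI _ B mB; rewrite setTI; apply: sub_gen_smallest.
by exists A, B; split => //; left.
Qed.

Lemma measurable_Xminus A : measurable A -> A `<=` Iopen Im Ip ->
  measurable_fun setT (fun X : Sord => Xminus X A).
Proof.
move=> mA AI _ B mB; rewrite setTI; apply: sub_gen_smallest.
by exists A, B; split => //; right.
Qed.

Lemma Mminus_ge (X : Sord) : Im <= Mminus X.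
Proof. by apply: ereal_sup_ubound; left. Qed.

Lemma Mplus_le (X : Sord) : Mplus X <= Ip.
Proof. by apply: ereal_inf_lbound; left. Qed.

(** This expresses a level set of the best buy price through the mass of a fixed set, that is,
    through a generator of the sigma-algebra. The first alternative accounts for the default value
    [Im] of an empty buy side. *)
Lemma lt_MminusP (X : Sord) x : x < Mminus X <->
  x < Im \/ Xminus X [set y | x < y /\ Iopen Im Ip y] != 0.
Proof.
have [_ c2 _ _] := book_pairP X; split => [xM|[xI|/eqP]].
- case: (Mminus_max X) => [ME|[IM _]]; first by left; rewrite -ME.
  right; apply/eqP => /(counting_eq0P _ c2)/(_ (Mminus X)) M0.
  by have := Mminus_atom IM; rewrite /Xminus M0// ltxx.
- exact: lt_le_trans (Mminus_ge X).
- rewrite ltNge => nz; apply/negP => Mx; apply/nz/(counting_eq0P _ c2).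
  move=> y [xy Iy]; apply/eqP; rewrite eq_le Xminus_ge0 andbT leNgt.
  apply/negP => /(atom_le_Mminus Iy); apply/negP; rewrite -ltNge.
  exact: le_lt_trans xy.
Qed.

Lemma lt_MplusP (X : Sord) x : Mplus X < x <->
  Ip < x \/ Xplus X [set y | y < x /\ Iopen Im Ip y] != 0.
Proof.
have [c1 _ _ _] := book_pairP X; split => [xM|[xI|/eqP]].
- case: (Mplus_min X) => [ME|[IM _]]; first by left; rewrite -ME.
  right; apply/eqP => /(counting_eq0P _ c1)/(_ (Mplus X)) M0.
  by have := Mplus_atom IM; rewrite /Xplus M0// ltxx.
- exact: le_lt_trans (Mplus_le X) _.
- rewrite ltNge => nz; apply/negP => Mx; apply/nz/(counting_eq0P _ c1).
  move=> y [xy Iy]; apply/eqP; rewrite eq_le Xplus_ge0 andbT leNgt.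
  apply/negP => /(Mplus_le_atom Iy); apply/negP; rewrite -ltNge.
  exact: lt_le_trans xy _.
Qed.

Lemma measurable_Mminus : measurable_fun setT (@Mminus R Im Ip : Sord -> _).
Proof.
move=> _; apply: (measurability _ (ErealGenOInfty.measurableE R)) => //.
move=> _ [_ [r ->] <-]; rewrite setTI.
pose A := [set y | r%:E < y /\ Iopen Im Ip y].
have mA : measurable A.
  rewrite (_ : A = `]r%:E, +oo[%classic `&` Iopen Im Ip).
    by apply: measurableI measurable_Iopen; exact: emeasurable_itv.
  by apply/seteqP; split => y /=; rewrite in_itv/= andbT.
rewrite (_ : _ @^-1` _ =
  [set X : Sord | r%:E < Im] `|` (fun X : Sord => Xminus X A) @^-1` [set~ 0]).
  apply: measurableU; first by case: (_ < _); rewrite ?set_true ?set_false.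
  rewrite -[X in measurable X]setTI; apply: measurable_Xminus => //.
    by move=> x [].
  exact: measurableC.
apply/seteqP; split => X /=; rewrite in_itv/= andbT.
  by move=> /lt_MminusP[|/eqP]; [left|right].
by move=> XA; apply/lt_MminusP; case: XA => [|/eqP]; [left|right].
Qed.

Lemma measurable_Mplus : measurable_fun setT (@Mplus R Im Ip : Sord -> _).
Proof.
move=> _; apply: (measurability _ (ErealGenInftyO.measurableE R)) => //.
move=> _ [_ [r ->] <-]; rewrite setTI.
pose A := [set y | y < r%:E /\ Iopen Im Ip y].
have mA : measurable A.
  rewrite (_ : A = `]-oo, r%:E[%classic `&` Iopen Im Ip).
    by apply: measurableI measurable_Iopen; exact: emeasurable_itv.
  by apply/seteqP; split => y /=; rewrite in_itv/=.
rewrite (_ : _ @^-1` _ =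
  [set X : Sord | Ip < r%:E] `|` (fun X : Sord => Xplus X A) @^-1` [set~ 0]).
  apply: measurableU; first by case: (_ < _); rewrite ?set_true ?set_false.
  rewrite -[X in measurable X]setTI; apply: measurable_Xplus => //.
    by move=> x [].
  exact: measurableC.
apply/seteqP; split => X /=; rewrite in_itv/=.
  by move=> /lt_MplusP[|/eqP]; [left|right].
by move=> XA; apply/lt_MplusP; case: XA => [|/eqP]; [left|right].
Qed.

Let mu1 : measurable_fun setT (fun z : (\bar R * bool) * Sord => z.1.1).
Proof. exact: measurableT_comp. Qed.

Let mu2 : measurable_fun setT (fun z : (\bar R * bool) * Sord => z.1.2).
Proof. exact: measurableT_comp. Qed.

Let mMm : measurable_fun setT (fun z : (\bar R * bool) * Sord => Mminus z.2).
Proof. by apply: measurableT_comp => //; exact: measurable_Mminus. Qed.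

Let mMp : measurable_fun setT (fun z : (\bar R * bool) * Sord => Mplus z.2).
Proof. by apply: measurableT_comp => //; exact: measurable_Mplus. Qed.

Let measurable_and3 (b : bool) (f : (\bar R * bool) * Sord -> \bar R) A
    (E : set ((\bar R * bool) * Sord)) :
  measurable A -> measurable_fun setT f -> measurable E ->
  measurable [set z : (\bar R * bool) * Sord | [/\ z.1.2 = b, A (f z) & E z]].
Proof.
move=> mA mf mE.
rewrite (_ : mkset _ = (fun z => z.1.2) @^-1` [set b] `&` f @^-1` A `&` E).
  apply: measurableI => //; apply: measurableI.
    by rewrite -[X in measurable X]setTI; exact: mu2.
  by rewrite -[X in measurable X]setTI; exact: mf.
by apply/seteqP; split => z /=; [case|case=> -[]].
Qed.

Lemma measurable_sell_added A : measurable A -> measurable (@sell_added R Im Ip A).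
Proof. by move=> mA; apply: measurable_and3 => //; exact: emeasurable_lt. Qed.

Lemma measurable_sell_removed A : measurable A ->
  measurable (@sell_removed R Im Ip A).
Proof. by move=> mA; apply: measurable_and3 => //; exact: emeasurable_le. Qed.

Lemma measurable_buy_added A : measurable A -> measurable (@buy_added R Im Ip A).
Proof. by move=> mA; apply: measurable_and3 => //; exact: emeasurable_lt. Qed.

Lemma measurable_buy_removed A : measurable A ->
  measurable (@buy_removed R Im Ip A).
Proof. by move=> mA; apply: measurable_and3 => //; exact: emeasurable_le. Qed.

(** A generator sees the new book only through [Xplus] or [Xminus] of a set inside $I$, and the
    one-step formulas write these as old counts plus indicators of measurable events. *)
Lemma measurable_luckock :
  measurable_fun setT (fun z : (\bar R * bool) * Sord => luckock z.1 z.2).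
Proof.
apply: (@measurability _ _ _ Sord setT _ (@book_gen R Im Ip)) => //.
move=> _ [_E [A [B [mA AI mB BE]]] <-].
rewrite setTI.
have mXp : measurable_fun setT (fun z : (\bar R * bool) * Sord => Xplus z.2 A).
  exact: (measurableT_comp (measurable_Xplus mA AI) measurable_snd).
have mXm : measurable_fun setT (fun z : (\bar R * bool) * Sord => Xminus z.2 A).
  exact: (measurableT_comp (measurable_Xminus mA AI) measurable_snd).
have mI E : measurable E -> measurable_fun setT
    (fun z : (\bar R * bool) * Sord => (\1_E z : R)%:E).
  by move=> mE; apply/measurable_EFinP; exact: measurable_indic.
case: BE => ->.
- have := emeasurable_funB (emeasurable_funD mXp (mI _ (measurable_sell_added mA)))
    (mI _ (measurable_sell_removed mA)).
  move=> /(_ measurableT _ mB); rewrite setTI; congr (_ _).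
  by apply/seteqP; split => -[w X] /=; rewrite Xplus_luckock.
- have := emeasurable_funB (emeasurable_funD mXm (mI _ (measurable_buy_added mA)))
    (mI _ (measurable_buy_removed mA)).
  move=> /(_ measurableT _ mB); rewrite setTI; congr (_ _).
  by apply/seteqP; split => -[w X] /=; rewrite Xminus_luckock.
Qed.

End order_book_measurability.

HB.instance Definition _ (R : realType) (Im Ip : \bar R) :=
  isMeasurableFun.Build _ _ _ _ (@Mminus R Im Ip : Sord Im Ip -> \bar R)
    (@measurable_Mminus R Im Ip).

HB.instance Definition _ (R : realType) (Im Ip : \bar R) :=
  isMeasurableFun.Build _ _ _ _ (@Mplus R Im Ip : Sord Im Ip -> \bar R)
    (@measurable_Mplus R Im Ip).

(** * Stationarity *)

Section joint_law.
Context d d1 d2 (Omega : measurableType d) (T1 : measurableType d1)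
  (T2 : measurableType d2) (R : realType).

(** [P] is any measure, because the lemma is applied to restrictions of a probability to an event
    and to its multiples. Agreement on rectangles suffices by uniqueness of the product of finite
    measures. *)
Lemma joint_lawE (P : {measure set Omega -> \bar R}) (h : Omega -> T1 * T2)
    (m1 : {finite_measure set T1 -> \bar R})
    (m2 : {finite_measure set T2 -> \bar R}) :
  measurable_fun setT h ->
  (forall A B, measurable A -> measurable B ->
    P (h @^-1` (A `*` B)) = m1 A * m2 B) ->
  forall E, measurable E -> P (h @^-1` E) = (m1 \x m2) E.
Proof.
move=> mh PAB E mE; pose m' : {measure set (T1 * T2) -> \bar R} :=
  measure_function_pushforward__canonical__measure_function_Measure P mh.
by rewrite (product_measure_unique (m' := m')).
Qed.

End joint_law.

Lemma law_measurable d d' (Omega : measurableType d) (T : measurableType d')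
    (f : {mfun Omega >-> T}) (A : set T) :
  measurable A -> measurable (f @^-1` A).
Proof. by move=> mA; rewrite -[X in measurable X]setTI; exact: measurable_funP. Qed.

Section stationarity.
Context (R : realType) (Im Ip : \bar R)
  (mu : {finite_measure set (\bar R * bool)%type -> \bar R})
  (d : measure_display) (Omega : measurableType d) (P : probability Omega R)
  (X : nat -> {RV P >-> Sord Im Ip})
  (W : nat -> {RV P >-> (\bar R * bool)%type}).
Hypothesis XW : stigler_luckock mu X W.

Local Notation cylinder J B := (\bigcap_(j in [set` J]) (W j @^-1` B j)).

(** Carrying all inputs from time [k] on makes the statement inductive: $X_{k+1}$ is a function of
    $(W_k,X_k)$, and the inputs that remain are those with index beyond [k]. *)
Let indep_from k := forall (A : set (Sord Im Ip)) (J : {fset nat})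
    (B : nat -> set (\bar R * bool)%type),
  measurable A -> (forall j, measurable (B j)) ->
  (forall j, j \in J -> (k <= j)%N) ->
  P (X k @^-1` A `&` cylinder J B) =
  P (X k @^-1` A) * \prod_(j <- J) P (W j @^-1` B j).

Local Notation WX k := (fun w => (W k w, X k w)).

Let mWX k : measurable_fun setT (WX k).
Proof. by apply: measurable_fun_pair; exact: measurable_funP. Qed.

Let measurable_cylinder (J : {fset nat}) (B : nat -> set (\bar R * bool)%type) :
  (forall j, measurable (B j)) -> measurable (cylinder J B).
Proof.
move=> mB; apply: fin_bigcap_measurable => // j _; exact: law_measurable.
Qed.

Let indep_rect k (J : {fset nat}) (B : nat -> set (\bar R * bool)%type) A B0 :
  indep_from k -> (forall j, measurable (B j)) ->
  (forall j, j \in J -> (k < j)%N) -> measurable B0 -> measurable A ->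
  P (WX k @^-1` (B0 `*` A) `&` cylinder J B) =
  P (W k @^-1` B0) * P (X k @^-1` A) * \prod_(j <- J) P (W j @^-1` B j).
Proof.
move=> ind mB kJ mB0 mA.
have kNJ : k \notin J by apply/negP => /kJ; rewrite ltnn.
pose B' j := if j == k then B0 else B j.
have B'J j : j \in J -> B' j = B j.
  by move=> jJ; rewrite /B'; case: eqP => // jk; move: kNJ; rewrite -jk jJ.
have mB' j : measurable (B' j) by rewrite /B'; case: ifP.
have kJ' j : j \in (k |` J)%fset -> (k <= j)%N.
  by rewrite !inE => /predU1P[->//|/kJ/ltnW].
have -> : \prod_(j <- J) P (W j @^-1` B j) = \prod_(j <- J) P (W j @^-1` B' j).
  by apply: eq_big_seq => j jJ; rewrite B'J.
rewrite (_ : B0 = B' k); last by rewrite /B' eqxx.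
transitivity (P (X k @^-1` A `&` cylinder (k |` J)%fset B')); last first.
  by rewrite ind// big_fsetU1//= muleCA muleA.
congr (P _); apply/seteqP; split => w /=.
  move=> [[WB0 XA] WJ]; split => // j /=; rewrite !inE => /predU1P[->//|jJ].
  by rewrite B'J//; exact: WJ.
move=> [XA WJ]; split.
  by split => //; apply: (WJ k); rewrite /= !inE eqxx.
by move=> j jJ; rewrite -B'J//; apply: WJ; rewrite /= !inE [j \in J]jJ orbT.
Qed.

Let indep_rect0 k B A : indep_from k -> measurable B -> measurable A ->
  P (WX k @^-1` (B `*` A)) = P (W k @^-1` B) * P (X k @^-1` A).
Proof.
move=> ind mB mA; have := @indep_rect k fset0 (fun=> setT) A B ind.
rewrite set_fset0 bigcap_set0 setIT big_seq_fset0 mule1.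
by apply.
Qed.

(** [P] restricted to the cylinder and [P] multiplied by the cylinder's probability [c] give the
    same mass to preimages of rectangles. Both therefore have the image $m_1\times m_2$, where the
    factor [c] is put into [m2]. *)
Let indep_pair k (J : {fset nat}) (B : nat -> set (\bar R * bool)%type) :
  indep_from k -> (forall j, measurable (B j)) ->
  (forall j, j \in J -> (k < j)%N) ->
  forall E, measurable E -> P (WX k @^-1` E `&` cylinder J B) =
  P (WX k @^-1` E) * \prod_(j <- J) P (W j @^-1` B j).
Proof.
move=> ind mB kJ E mE.
set c := \prod_(j <- J) _.
have c0 : 0 <= c by rewrite /c prode_ge0// => j _; exact: measure_ge0.
have cfin : c \is a fin_num.
  by rewrite /c prode_fin_num// => j _; rewrite fin_num_measure//; exact: law_measurable.
have fc0 : (0 <= fine c)%R by exact: fine_ge0.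
pose m2 : {finite_measure set (Sord Im Ip) -> \bar R} :=
  mscale (NngNum fc0) (distribution P (X k)).
pose m1 : {finite_measure set (\bar R * bool)%type -> \bar R} :=
  distribution P (W k).
have mC := measurable_cylinder J mB.
transitivity ((m1 \x m2) E).
  rewrite -(@joint_lawE _ _ _ _ _ _ _ (mrestr P mC) (WX k))// => A' B' mA mB'.
  rewrite -[LHS]/(P (WX k @^-1` (A' `*` B') `&` cylinder J B)).
  rewrite -[m2 B']/((fine c)%:E * P (X k @^-1` B')) fineK//.
  by rewrite indep_rect// -muleA [X in _ * X]muleC.
rewrite -(@joint_lawE _ _ _ _ _ _ _ (mscale (NngNum fc0) P) (WX k))//.
  by rewrite -[LHS]/((fine c)%:E * P (WX k @^-1` E)) fineK// muleC.
move=> A' B' mA mB'.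
rewrite -[LHS]/((fine c)%:E * P (WX k @^-1` (A' `*` B'))).
by rewrite indep_rect0// muleCA.
Qed.

Let indep_all k : indep_from k.
Proof.
have [_ ind0 step] := XW.
elim: k => [|k IH] A J B mA mB kJ; first exact: ind0.
have XE : X k.+1 @^-1` A =
    WX k @^-1` ((fun z => luckock z.1 z.2) @^-1` A).
  by apply/seteqP; split => w /=; rewrite step.
rewrite XE indep_pair//.
by rewrite -[X in measurable X]setTI; exact: measurable_luckock.
Qed.

Lemma stigler_luckock_indep k A B : measurable A -> measurable B ->
  P (WX k @^-1` (B `*` A)) = P (W k @^-1` B) * P (X k @^-1` A).
Proof.
by move=> mA mB; exact: indep_rect0.
Qed.

(** [invariant_law] speaks only of the first step. Whenever $X_j$ has law [nu], the law of $X_{j+1}$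
    is the image of one and the same product measure, so every later step is compared with step
    0. *)
Lemma stigler_luckock_stationary (nu : probability (Sord Im Ip) R) k :
  invariant_law mu nu -> has_law (X 0%N) nu -> has_law (X k) nu.
Proof.
move=> inv law0.
have [lawW _ step] := XW.
have law1 := inv _ _ _ _ _ XW law0.
elim: k => // k IH A mA.
pose m1 : {finite_measure set (\bar R * bool)%type -> \bar R} :=
  distribution P (W 0%N).
have PE j : has_law (X j) nu -> distribution P (X j.+1) A =
    (m1 \x nu) ((fun z => luckock z.1 z.2) @^-1` A).
  move=> lawj; rewrite -(@joint_lawE _ _ _ _ _ _ _ P (WX j))//.
  - by congr (P _); apply/seteqP; split => w /=; rewrite step.
  - move=> B A' mB mA'; rewrite -[LHS]/(P (WX j @^-1` (B `*` A'))).
    rewrite stigler_luckock_indep//.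
    rewrite -[P (X j @^-1` A')]/(distribution P (X j) A') lawj//.
    by rewrite -[P (W j @^-1` B)]/(distribution P (W j) B) lawW// /m1/= lawW.
  - by rewrite -[X in measurable X]setTI; exact: measurable_luckock.
by rewrite PE// -(PE 0%N)// law1.
Qed.

End stationarity.

(** * Balance of arrivals and departures *)

(** Truncation does not enlarge increments; this yields the dominating constant 1 in the balance
    argument. *)
Lemma ler_dist_min (R : realDomainType) (a b c : R) :
  (`|Num.min a c - Num.min b c| <= `|a - b|)%R.
Proof.
wlog ab : a b / (a <= b)%R.
  move=> H; have [ab|/ltW ba] := leP a b; first exact: H.
  by rewrite distrC [leRHS]distrC; exact: H.
rewrite [leRHS]ler0_norm ?subr_le0// ler_norml.
by case: (leP b c); case: (leP a c) => *; apply/andP; split; lra.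
Qed.

Section balance.
Context d d' (Omega : measurableType d) (T : measurableType d') (R : realType)
  (P : probability Omega R).

(* The count [c] need not be integrable: truncated at [n] it has the same finite
   mean before and after the step, with increments bounded by 1. *)
Lemma stationary_count_balance (X0 X1 : {RV P >-> T}) (c : T -> R)
    (add rem : set Omega) :
  measurable_fun setT c -> (forall x, 0 <= c x)%R ->
  (forall A, measurable A -> distribution P X1 A = distribution P X0 A) ->
  measurable add -> measurable rem ->
  (forall w, c (X1 w) = c (X0 w) + \1_add w - \1_rem w)%R ->
  P add = P rem.
Proof.
move=> mc c0 law madd mrem cE.
pose h n x := (Num.min (c x) n%:R)%:E : \bar R.
have mh n : measurable_fun setT (h n).
  by apply/measurable_EFinP; exact: measurable_minr.
have h0 n x : 0 <= h n x by rewrite lee_fin le_min c0/=.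
have mhX n (Y : {RV P >-> T}) : measurable_fun setT (h n \o Y).
  exact: measurableT_comp.
have ih n (Y : {RV P >-> T}) : P.-integrable setT (h n \o Y).
  apply: (le_integrable measurableT _ _ (finite_measure_integrable_cst P n%:R _)) => //.
  move=> w _ /=; rewrite lee_fin ger0_norm ?le_min ?c0//=.
  by rewrite ger0_norm// ge_min lexx orbT.
have hE n : \int[P]_w (h n \o X1) w = \int[P]_w (h n \o X0) w.
  rewrite -!ge0_integral_distribution//.
  by apply: eq_measure_integral => A mA _; exact: law.
pose f n w := (h n \o X1) w - (h n \o X0) w.
have f0 n : \int[P]_w f n w = 0.
  rewrite integralB// hE subee//.
  by apply: integrable_fin_num => //; exact: ih.
pose g w := ((\1_add w - \1_rem w)%:E : \bar R).
have [] := @dominated_convergence _ _ _ P setT measurableT f g (cst 1).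
- by move=> n; apply: emeasurable_funB.
- by apply/measurable_EFinP; apply: measurable_funB; exact: measurable_indic.
(* Once [n] exceeds both counts the truncation is inactive, so the sequence is eventually constant
   at each [w]. *)
- apply: aeW => w _; apply: cvg_near_cst; near=> n.
  have cn x : (c x <= n%:R)%R -> Num.min (c x) n%:R = c x by move=> /min_l.
  rewrite /f /h/= !cn.
  + by rewrite -EFinB cE; congr EFin; ring.
  + by near: n; exact: nbhs_infty_ger.
  + by near: n; exact: nbhs_infty_ger.
- exact: finite_measure_integrable_cst.
- apply: aeW => w n _; rewrite /f /h/= lee_fin.
  apply: (le_trans (ler_dist_min _ _ _)).
  rewrite cE (_ : _ - _ = \1_add w - \1_rem w)%R; last by ring.
  by rewrite !indicE; case: (_ \in add); case: (_ \in rem) => /=;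
    rewrite ?subrr ?subr0 ?sub0r ?normrN ?normr0 ?normr1.
move=> _ _; rewrite (_ : [sequence _]_n = cst 0); last exact/funext.
move=> /cvg_lim => /(_ (@ereal_hausdorff R)); rewrite lim_cst//.
rewrite /g; under eq_integral do rewrite EFinB.
rewrite integralB//; [|exact: integrable_indic..].
rewrite !integral_indic// !setIT => /esym/eqP.
by rewrite sube_eq ?fin_num_measure// ?add0e => /eqP.
Unshelve. all: by end_near. Qed.

(** The balance is first obtained on sets where the counts are finite. Continuity of [P] from below
    along [D] extends it; [V] and [V'] stand for the price of the arriving order and the best
    price. *)
Lemma eq_preimage_exhaust (V V' : Omega -> \bar R) (E E' : set Omega)
    (D : nat -> set (\bar R)) :
  measurable_fun setT V -> measurable_fun setT V' ->
  measurable E -> measurable E' ->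
  (forall n, measurable (D n)) -> nondecreasing_seq D ->
  (forall n A, measurable A -> A `<=` D n ->
    P (V @^-1` A `&` E) = P (V' @^-1` A `&` E')) ->
  forall A, measurable A -> A `<=` \bigcup_n D n ->
    P (V @^-1` A `&` E) = P (V' @^-1` A `&` E').
Proof.
move=> mV mV' mE mE' mD ndD PD A mA AD.
have cvgP V0 E0 : measurable_fun setT V0 -> measurable E0 ->
    (fun n => P (V0 @^-1` (A `&` D n) `&` E0)) @ \oo --> P (V0 @^-1` A `&` E0).
  move=> mV0 mE0.
  have AE : V0 @^-1` A `&` E0 = \bigcup_n (V0 @^-1` (A `&` D n) `&` E0).
    rewrite -setI_bigcupl -preimage_bigcup -setI_bigcupr.
    by rewrite (setIidl AD).
  have mF n : measurable (V0 @^-1` (A `&` D n) `&` E0).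
    apply: measurableI => //; rewrite -[X in measurable X]setTI.
    by apply: mV0 => //; exact: measurableI.
  rewrite [in X in _ --> X]AE; apply: nondecreasing_cvg_mu => //.
  - exact: bigcup_measurable.
  - move=> n m nm; apply/subsetPset => w [[VA VD] Ew]; split => //; split => //.
    by have /subsetPset := ndD _ _ nm; apply.
have VV' : (fun n => P (V @^-1` (A `&` D n) `&` E)) =
    (fun n => P (V' @^-1` (A `&` D n) `&` E')).
  apply/funext => n; apply: (PD n); last by move=> x [].
  exact: (measurableI _ _ mA (mD n)).
have := cvgP _ _ mV mE; rewrite VV' => cvgV.
exact: (cvg_unique (@ereal_hausdorff R) cvgV (cvgP _ _ mV' mE')).
Qed.

End balance.

Lemma Iopen_cofinal (R : realType) (Im Ip : \bar R) : Im < Ip ->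
  exists x : nat -> \bar R, [/\ forall n, Iopen Im Ip (x n),
    {homo x : n m / (n <= m)%N >-> n <= m} &
    forall y, Iopen Im Ip y -> exists n, y < x n].
Proof.
move=> II; set a := contract Im; set b := contract Ip.
have ab : (0 < b - a)%R by rewrite subr_gt0 lt_contract.
(* Working in the [contract] coordinate treats finite and infinite endpoints alike. The denominator
   starts at 2 so that already [t 0] lies strictly above [a]. *)
pose t n : R := (b - (b - a) / n.+2%:R)%R.
have tb n : (t n < b)%R by rewrite ltrBlDr ltrDl divr_gt0.
have at_ n : (a < t n)%R.
  rewrite ltrBrDl -ltrBrDr ltr_pdivrMr// ltr_pMr//.
  by rewrite (ltr_nat _ 1).
have t1 n : t n \in [pred r : R | (`|r| <= 1)%R].
  have /ler_normlP[a1 _] := contract_le1 Im; have /ler_normlP[_ b1] := contract_le1 Ip.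
  rewrite inE ler_norml (le_trans _ (ltW (at_ n))) 1?lerNl//=.
  exact: le_trans (ltW (tb n)) b1.
exists (fun n => expand (t n)); split.
- by move=> n; rewrite /Iopen/= lt_expandLR// lt_expandRL// at_ tb.
- move=> n m nm /=; rewrite le_expand_in// lerD2l lerN2.
  apply: ler_wpM2l; first exact: ltW.
  by rewrite lef_pV2 ?posrE// ler_nat !ltnS.
- move=> y /andP[Iy yI].
  have yb : (contract y < b)%R by rewrite lt_contract.
  (* This choice makes $(b-a)/(n+2)$ smaller than the gap between [contract y] and [b]. *)
  pose n := Num.truncn ((b - a) / (b - contract y))%R.
  exists n; rewrite /= lt_expandRL// ltrBrDl -ltrBrDr.
  rewrite ltr_pdivrMr// mulrC -ltr_pdivrMr ?subr_gt0//.
  rewrite (lt_trans (truncnS_gt _))// ltr_nat.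
  by rewrite /n ltnS.
Qed.

Section luckock_balance.
Context (R : realType) (Im Ip : \bar R) d (Omega : measurableType d)
  (P : probability Omega R) (X0 X1 : {RV P >-> Sord Im Ip})
  (W : {RV P >-> (\bar R * bool)%type}).
Hypothesis II : Im < Ip.
Hypothesis step : forall w, X1 w = luckock (W w) (X0 w).
Hypothesis law : forall A, measurable A ->
  distribution P X1 A = distribution P X0 A.

Lemma le_counting (m : set (\bar R) -> \bar R) A B :
  counting_on (Iopen Im Ip) m -> A `<=` B -> m A <= m B.
Proof.
move=> [D [s [_ ->]]] AB; apply: le_esum => k _; rewrite !diracE lee_fin ler_nat.
by case: (boolP (_ \in A)) => // /set_mem/AB/mem_set ->.
Qed.

Local Notation WX := (fun w => (W w, X0 w)).

Let mWX (E : set ((\bar R * bool) * Sord Im Ip)) : measurable E -> measurable (WX @^-1` E).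
Proof.
move=> mE; rewrite -[X in measurable X]setTI.
by apply: measurable_fun_pair mE => //; exact: measurable_funP.
Qed.

(** The bound by a point [x] of $I$ makes [Xplus Y A] finite for every book, by the last clause of
    [ordered_pair], so [fine] gives a true real-valued count. *)
Let sell_balance_bounded A x : measurable A -> Iopen Im Ip x ->
  A `<=` [set y | Im < y < x] ->
  P (WX @^-1` sell_added A) = P (WX @^-1` sell_removed A).
Proof.
move=> mA Ix Ax.
have AI : A `<=` Iopen Im Ip.
  move=> y /Ax/andP[Iy yx]; rewrite /Iopen/= Iy.
  by case/andP: Ix => _; exact: lt_trans.
have fin (Y : Sord Im Ip) : Xplus Y A \is a fin_num.
  have [c1 _ _ /(_ x Ix)[_ f1]] := book_pairP Y.
  rewrite ge0_fin_numE ?Xplus_ge0//; apply: le_lt_trans f1.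
  exact: le_counting c1 Ax.
apply: (@stationary_count_balance _ _ _ _ _ P X0 X1 (fun Y => fine (Xplus Y A))) => //.
- by apply: measurableT_comp => //; exact: measurable_Xplus.
- by move=> Y; rewrite fine_ge0// Xplus_ge0.
- by apply: mWX; exact: measurable_sell_added.
- by apply: mWX; exact: measurable_sell_removed.
- move=> w; rewrite step Xplus_luckock//.
  by rewrite -[in LHS](fineK (fin (X0 w))) -!EFinD.
Qed.

Let buy_balance_bounded A x : measurable A -> Iopen Im Ip x ->
  A `<=` [set y | x < y < Ip] ->
  P (WX @^-1` buy_added A) = P (WX @^-1` buy_removed A).
Proof.
move=> mA Ix Ax.
have AI : A `<=` Iopen Im Ip.
  move=> y /Ax/andP[xy yI]; rewrite /Iopen/= yI andbT.
  by case/andP: Ix => Ix _; exact: lt_trans xy.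
have fin (Y : Sord Im Ip) : Xminus Y A \is a fin_num.
  have [_ c1 _ /(_ x Ix)[f1 _]] := book_pairP Y.
  rewrite ge0_fin_numE ?Xminus_ge0//; apply: le_lt_trans f1.
  exact: le_counting c1 Ax.
apply: (@stationary_count_balance _ _ _ _ _ P X0 X1 (fun Y => fine (Xminus Y A))) => //.
- by apply: measurableT_comp => //; exact: measurable_Xminus.
- by move=> Y; rewrite fine_ge0// Xminus_ge0.
- by apply: mWX; exact: measurable_buy_added.
- by apply: mWX; exact: measurable_buy_removed.
- move=> w; rewrite step Xminus_luckock//.
  by rewrite -[in LHS](fineK (fin (X0 w))) -!EFinD.
Qed.

Let mfstW : measurable_fun setT (fun w => (W w).1).
Proof. by apply: measurableT_comp => //; exact: measurable_funP. Qed.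

Lemma sell_balance A : measurable A -> A `<=` Iopen Im Ip ->
  P (WX @^-1` sell_added A) = P (WX @^-1` sell_removed A).
Proof.
(* Both events are written as a preimage of the varying set intersected with a fixed event, the form
   that the exhaustion requires. *)
have addE B : WX @^-1` sell_added B =
    (fun w => (W w).1) @^-1` B `&` WX @^-1` sell_added setT.
  by apply/seteqP; split => w /=; [case|case=> ? []].
have remE B : WX @^-1` sell_removed B =
    (@Mplus R Im Ip \o X0) @^-1` B `&` WX @^-1` sell_removed setT.
  by apply/seteqP; split => w /=; [case|case=> ? []].
have [x [Ix ndx xI]] := Iopen_cofinal II.
move=> mA AI; rewrite addE remE.
apply: (@eq_preimage_exhaust _ _ _ _ _ _ _ _ (fun n => [set y | Im < y < x n])) => //.
- by apply: measurableT_comp; [exact: measurable_Mplus|exact: measurable_funP].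
- by apply: mWX; exact: measurable_sell_added.
- by apply: mWX; exact: measurable_sell_removed.
- by move=> n; exact: measurable_Iopen.
- move=> n m nm; apply/subsetPset => y /= /andP[-> yx].
  exact: lt_le_trans yx (ndx _ _ nm).
- by move=> n B mB Bx; rewrite -addE -remE; exact: sell_balance_bounded Bx.
- move=> y /AI Iy; have [n yn] := xI y Iy; exists n => //=.
  by case/andP: Iy => ->.
Qed.

Lemma buy_balance A : measurable A -> A `<=` Iopen Im Ip ->
  P (WX @^-1` buy_added A) = P (WX @^-1` buy_removed A).
Proof.
have addE B : WX @^-1` buy_added B =
    (fun w => (W w).1) @^-1` B `&` WX @^-1` buy_added setT.
  by apply/seteqP; split => w /=; [case|case=> ? []].
have remE B : WX @^-1` buy_removed B =
    (@Mminus R Im Ip \o X0) @^-1` B `&` WX @^-1` buy_removed setT.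
  by apply/seteqP; split => w /=; [case|case=> ? []].
(* Buy orders can accumulate only at [Im]. Reflecting the interval turns the increasing sequence
   into one that decreases to [Im]. *)
have [|x [Ix ndx xI]] := @Iopen_cofinal _ (- Ip) (- Im); first by rewrite lteN2.
move=> mA AI; rewrite addE remE.
apply: (@eq_preimage_exhaust _ _ _ _ _ _ _ _ (fun n => [set y | - x n < y < Ip])) => //.
- by apply: measurableT_comp; [exact: measurable_Mminus|exact: measurable_funP].
- by apply: mWX; exact: measurable_buy_added.
- by apply: mWX; exact: measurable_buy_removed.
- by move=> n; exact: measurable_Iopen.
- move=> n m nm; apply/subsetPset => y /= /andP[xy ->]; rewrite andbT.
  by apply: le_lt_trans xy; rewrite leeN2; exact: ndx.
- move=> n B mB Bx; rewrite -addE -remE; apply: buy_balance_bounded Bx => //.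
  by have /andP[? ?] := Ix n; rewrite /Iopen/= lteNr lteNl; apply/andP.
- move=> y /AI/andP[Iy yI]; have [|n yn] := xI (- y).
    by rewrite /Iopen/= !lteN2 Iy yI.
  by exists n => //=; rewrite lteNl yn.
Qed.

End luckock_balance.

(** * Fubini for an independent order *)

Section marked_independence.
Context d dT (Omega : measurableType d) (T : measurableType dT) (R : realType)
  (P : probability Omega R) (Y : {RV P >-> T})
  (W : {RV P >-> (\bar R * bool)%type}) (f : {mfun T >-> \bar R})
  (b : bool) (m : {finite_measure set (\bar R) -> \bar R}) (c : {nonneg R}).
Hypothesis indep : forall A B, measurable A -> measurable B ->
  P ((fun w => (W w, Y w)) @^-1` (B `*` A)) = P (W @^-1` B) * P (Y @^-1` A).
Hypothesis lawW : forall B, measurable B ->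
  P (W @^-1` (B `*` [set b])) = c%:num%:E * m B.

Let h w := (f (Y w), (W w).1).

Let mh : measurable_fun setT h.
Proof.
apply: measurable_fun_pair; first exact: measurableT_comp.
exact: measurableT_comp.
Qed.

Let C := W @^-1` (setT `*` [set b]).

Let mC : measurable C.
Proof. by apply: law_measurable; exact: measurableX. Qed.

(** On the event that the order is on side [b], the statistic [f (Y w)] and the price have a product
    law whose second factor is [c] times [m]. In the application [c] is $1/|\mu|$ and [m] is
    $\mu_\pm$. *)
Let marked_lawE (E : set (\bar R * \bar R)) : measurable E ->
  P (h @^-1` E `&` C) = (distribution P (f \o Y) \x mscale c m) E.
Proof.
move=> mE; rewrite -(@joint_lawE _ _ _ _ _ _ _ (mrestr P mC) h)// => A B mA mB.
rewrite -[LHS]/(P (h @^-1` (A `*` B) `&` C)).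
rewrite -[RHS]/(P (Y @^-1` (f @^-1` A)) * (c%:num%:E * m B)) -lawW// muleC.
rewrite -indep; last 2 first.
- exact: law_measurable.
- exact: measurableX.
by congr (P _); apply/seteqP; split => w /=; [move=> [[? ?] [_ ?]]|move=> [[? ?] ?]].
Qed.

Lemma marked_integral_price (r : set (\bar R * \bar R)) A :
  measurable r -> measurable A ->
  P [set w | [/\ (W w).2 = b, A (W w).1 & r (f (Y w), (W w).1)]] =
  c%:num%:E * \int[m]_(u in A) distribution P (f \o Y) (ysection r u).
Proof.
move=> mr mA.
have mE : measurable (r `&` (setT `*` A)).
  by apply: measurableI => //; exact: measurableX.
transitivity (P (h @^-1` (r `&` (setT `*` A)) `&` C)).
  by congr (P _); apply/seteqP; split => w /=; [case|case=> -[? [_ ?]] [_ ?]].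
rewrite marked_lawE//.
(* Fubini's theorem: the product measure is replaced by the one built with the other order of
   integration, which leaves the price as the outer variable. *)
rewrite (@product_measure_unique _ _ _ _ _ _ _
  (distribution P (f \o Y) \x^ mscale c m))//; last first.
  by move=> B D mB mD; exact: product_measure2E.
transitivity (\int[mscale c m]_u
    distribution P (f \o Y) (ysection (r `&` (setT `*` A)) u)) => //.
rewrite ge0_integral_mscale//=; last first.
  exact: measurable_fun_ysection.
congr (_ * _); rewrite [RHS]integral_mkcond; apply: eq_integral => u _ /=.
rewrite patchE ysectionI; case: ifPn => uA.
  by rewrite in_ysectionX// setIT.
by rewrite notin_ysectionX// setI0 measure0.
Qed.

Lemma marked_integral_state (r : set (\bar R * \bar R)) A :
  measurable r -> measurable A ->
  P [set w | [/\ (W w).2 = b, A (f (Y w)) & r (f (Y w), (W w).1)]] =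
  c%:num%:E * \int[distribution P (f \o Y)]_(y in A) m (xsection r y).
Proof.
move=> mr mA.
have mE : measurable (r `&` (A `*` setT)).
  by apply: measurableI => //; exact: measurableX.
transitivity (P (h @^-1` (r `&` (A `*` setT)) `&` C)).
  by congr (P _); apply/seteqP; split => w /=; [case|case=> -[? [? _]] [_ ?]].
rewrite marked_lawE// /product_measure1/=.
rewrite [in RHS]integral_mkcond -ge0_integralZl//; last 2 first.
- apply/(measurable_restrictT _ _).1 => //.
  by apply: measurable_funS (measurable_fun_xsection _ mr).
- by move=> y _; rewrite patchE; case: ifP.
apply: eq_integral => y _ /=.
rewrite patchE xsectionI; case: ifPn => yA.
  by rewrite in_xsectionX// setIT.
by rewrite notin_xsectionX// setI0 measure0 mule0.
Qed.

End marked_independence.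

(** * Differentials of distribution functions *)

Lemma integral_mrestr d (T : measurableType d) (R : realType)
    (m : {measure set T -> \bar R}) (D A : set T) (mD : measurable D)
    (f : T -> \bar R) :
  measurable A -> measurable_fun A f -> (forall x, A x -> 0 <= f x) ->
  \int[mrestr m mD]_(x in A) f x = \int[m]_(x in A `&` D) f x.
Proof.
move=> mA mf f0.
rewrite -{1}(setUIDK A D) ge0_integral_setU//=; first last.
- by apply/disj_setPS => x [[_ Dx] [_]].
- by move=> x [[]|[]] *; exact: f0.
- by rewrite setUIDK.
- exact: measurableD.
- exact: measurableI.
rewrite (eq_measure_integral m); last first.
  move=> B mB BA; transitivity (m (B `&` D)) => //.
  by rewrite setIidl// => x /BA[].
rewrite [X in _ + X](eq_measure_integral mzero); last first.
  move=> B mB BA; transitivity (m (B `&` D)) => //.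
  rewrite (_ : B `&` D = set0) ?measure0//.
  by apply/seteqP; split => // x [/BA[]].
by rewrite integral_measure_zero adde0.
Qed.

Section weighted_measure.
Context (R : realType).
Implicit Types (nu : {charge set (\bar R) -> \bar R})
  (m : {finite_measure set (\bar R) -> \bar R}) (g : \bar R -> R).

(** [weighted] relies on a Hahn decomposition picked by choice. Uniqueness of the Jordan parts
    allows any explicit decomposition to replace it. *)
Lemma jordan_hahnE nu Q M Q' M' (nuQM : hahn_decomposition nu Q M) :
  hahn_decomposition nu Q' M' -> forall B, measurable B ->
  jordan_pos nuQM B = nu (B `&` Q') /\ jordan_neg nuQM B = - nu (B `&` M').
Proof.
move=> h B mB; have [<- <-] := Hahn_decomposition_uniq nuQM h mB.
by rewrite jordan_posE cjordan_posE jordan_negE cjordan_negE /crestr0 mem_set.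
Qed.

(** The differential of a nondecreasing function is a measure; its Hahn decomposition is the whole
    space and the empty set, so [weighted] reduces to an ordinary integral. *)
Lemma weighted_measure nu m g A : (forall B, measurable B -> nu B = m B) ->
  measurable A -> weighted g nu A = \int[m]_(x in A) (g x)%:E.
Proof.
move=> num mA.
have hd : hahn_decomposition nu setT set0.
  split; [|split|by rewrite setU0|by rewrite setI0] => //.
    by split => // B mB _; rewrite num.
  by move=> B mB; rewrite subset0 => ->; rewrite charge0.
pose nuPN := projT2 (cid (projT2 (cid (Hahn_decomposition nu)))).
transitivity (\int[jordan_pos nuPN]_(x in A) (g x)%:E -
  \int[jordan_neg nuPN]_(x in A) (g x)%:E) => //.
rewrite (eq_measure_integral m); last first.
  move=> B mB _; apply: (etrans (jordan_hahnE nuPN hd mB).1); rewrite setIT num//.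
rewrite [X in _ - X](eq_measure_integral mzero); last first.
  move=> B mB _; apply: (etrans (jordan_hahnE nuPN hd mB).2).
  by rewrite setI0 charge0 oppe0.
by rewrite integral_measure_zero sube0.
Qed.

Lemma weighted_measureN nu m g A : (forall B, measurable B -> nu B = - m B) ->
  measurable A -> weighted g nu A = - \int[m]_(x in A) (g x)%:E.
Proof.
move=> num mA.
have hd : hahn_decomposition nu set0 setT.
  split; [split|split| |] => //; last 2 first.
  - by rewrite set0U.
  - by rewrite set0I.
  - by move=> B mB; rewrite subset0 => ->; rewrite charge0.
  - by move=> B mB _; rewrite num// oppe_le0.
pose nuPN := projT2 (cid (projT2 (cid (Hahn_decomposition nu)))).
transitivity (\int[jordan_pos nuPN]_(x in A) (g x)%:E -
  \int[jordan_neg nuPN]_(x in A) (g x)%:E) => //.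
rewrite (eq_measure_integral mzero); last first.
  move=> B mB _; apply: (etrans (jordan_hahnE nuPN hd mB).1).
  by rewrite setI0 charge0.
rewrite [X in _ - X](eq_measure_integral m); last first.
  move=> B mB _; apply: (etrans (jordan_hahnE nuPN hd mB).2).
  by rewrite setIT num// oppeK.
by rewrite integral_measure_zero sub0e.
Qed.

End weighted_measure.

Section cdf.
Context (R : realType) (m : {finite_measure set (\bar R) -> \bar R}).

Lemma emeasurable_le_set (x : \bar R) : measurable [set z | z <= x].
Proof.
by rewrite (_ : mkset _ = `]-oo, x]%classic); [exact: emeasurable_itv|];
  apply/seteqP; split => z; rewrite /= in_itv.
Qed.

Lemma emeasurable_ge_set (x : \bar R) : measurable [set z | x <= z].
Proof.
by rewrite (_ : mkset _ = `[x, +oo[%classic); [exact: emeasurable_itv|];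
  apply/seteqP; split => z; rewrite /= in_itv/= andbT.
Qed.

Lemma emeasurable_lt_set (x : \bar R) : measurable [set z | z < x].
Proof.
by rewrite (_ : mkset _ = `]-oo, x[%classic); [exact: emeasurable_itv|];
  apply/seteqP; split => z; rewrite /= in_itv.
Qed.

Lemma emeasurable_gt_set (x : \bar R) : measurable [set z | x < z].
Proof.
by rewrite (_ : mkset _ = `]x, +oo[%classic); [exact: emeasurable_itv|];
  apply/seteqP; split => z; rewrite /= in_itv/= andbT.
Qed.

Let fin B : measurable B -> m B \is a fin_num.
Proof. exact: fin_num_measure. Qed.

Lemma measure_cdfB x y : x <= y ->
  m [set z | x < z <= y] =
  (fine (m [set z | (z <= y)%E]) - fine (m [set z | (z <= x)%E]))%:E.
Proof.
move=> xy; have mx := emeasurable_le_set x; have my := emeasurable_le_set y.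
rewrite EFinB !fineK ?fin//.
rewrite (_ : mkset _ = [set z | z <= y] `\` [set z | z <= x]).
  rewrite measureD//; last by rewrite ltey_eq fin.
  by rewrite setIidr// => z /= zx; exact: (le_trans zx xy).
apply/seteqP; split => z /=.
  by move=> /andP[xz ->]; split => //; apply/negP; rewrite -ltNge.
by move=> [-> /negP]; rewrite -ltNge => ->.
Qed.

(** The balls [B n] around [x] in the metric of [\bar R] shrink to the null set $\{x\}$, so their
    masses tend to 0. They bound the increments of the distribution function near [x]. *)
Lemma continuous_cdf : (forall x, m [set x] = 0) ->
  continuous (fun x => fine (m [set z | z <= x])).
Proof.
move=> atomless x; pose B n := [set y | (`|contract x - contract y| < n.+1%:R^-1)%R].
have mB n : measurable (B n).
  have mf : measurable_fun setT (fun y : \bar R => `|contract x - contract y|%R).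
    apply: measurableT_comp => //; apply: measurable_funB => //.
    exact: measurable_contract.
  have := measurable_fun_ltr mf (measurable_cst (n.+1%:R^-1 : R)%R).
  by move=> /(_ measurableT [set true] Logic.I); rewrite setTI.
have capB : \bigcap_n B n = [set x].
  apply/seteqP; split => [y yB|y -> n _]; last by rewrite /B/= subrr normr0 invr_gt0.
  apply/esym/eqP; rewrite -(can_eq (@contractK R)) -subr_eq0 -normr_le0.
  apply/ler_addgt0Pr => e e0; rewrite add0r.
  have [n ne] : exists n, (n.+1%:R^-1 < e)%R.
    exists (Num.truncn e^-1); rewrite invf_plt ?posrE//; exact: truncnS_gt.
  by rewrite ltW// (lt_trans _ ne)//; exact: yB.
have cvgB : m \o B @ \oo --> 0.
  rewrite -(atomless x) -capB; apply: nonincreasing_cvg_mu => //.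
  - by rewrite ltey_eq fin.
  - exact: bigcap_measurable.
  - move=> i j ij; apply/subsetPset => y; rewrite /B/= => /lt_le_trans; apply.
    by rewrite lef_pV2 ?posrE// ler_nat.
apply/cvgrPdist_lt => e e0.
have [n Bn] : exists n, m (B n) < e%:E.
  have e1 : nbhs (0 : \bar R) [set y | y < e%:E].
    by apply: open_nbhs_nbhs; split => //; exact: open_ereal_lt_ereal.
  have [n _ /(_ n (leqnn n)) ?] := cvgB _ e1.
  by exists n.
apply/(@nbhs_ballP R (\bar R)); exists n.+1%:R^-1%R => /=; first by rewrite invr_gt0.
move=> y xy; have {}xy : (`|contract x - contract y| < n.+1%:R^-1)%R by exact: xy.
have key a b : a <= b -> [set z | a < z <= b] `<=` B n ->
    (`|fine (m [set z | (z <= b)%E]) - fine (m [set z | (z <= a)%E])| < e)%R.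
  move=> ab abB; rewrite -lte_fin; apply: le_lt_trans Bn.
  have h0 : 0 <= m [set z | a < z <= b] by exact: measure_ge0.
  rewrite ger0_norm -?lee_fin -?measure_cdfB//.
  rewrite le_measure ?inE//.
  rewrite (_ : mkset _ = [set z | a < z] `&` [set z | z <= b]).
    by apply: measurableI; [exact: emeasurable_gt_set|exact: emeasurable_le_set].
  by apply/seteqP; split => z /=; [move=> /andP|move=> [-> ->]].
have [xley|/ltW ylex] := leP x y.
  rewrite distrC; apply: key => // z /= /andP[xz zy]; apply: le_lt_trans xy.
  rewrite /B/= !ler0_norm ?subr_le0 ?le_contract// ?(ltW xz)//.
  by rewrite !opprB lerD2r le_contract.
apply: key => // z /= /andP[yz zx]; apply: le_lt_trans xy.
rewrite /B/= !ger0_norm ?subr_ge0 ?le_contract//.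
by rewrite lerD2l lerN2 le_contract ltW.
Qed.

End cdf.

Lemma eq_measure_mod_null d (T : measurableType d) (R : realType)
    (m : {measure set T -> \bar R}) (A B N : set T) :
  measurable A -> measurable B -> measurable N -> m N = 0 ->
  A `<=` B `|` N -> B `<=` A `|` N -> m A = m B.
Proof.
move=> mA mB mN N0 AB BA; apply/eqP; rewrite eq_le.
have le C D : measurable C -> measurable D -> C `<=` D `|` N -> m C <= m D.
  move=> mC mD CD; apply: (@le_trans _ _ (m (D `|` N))).
    by rewrite le_measure ?inE//; exact: measurableU.
  by apply: (le_trans (measureU2 _ mD mN)); rewrite [X in _ + X <= _]N0 adde0.
by rewrite !le.
Qed.

Lemma approach_left (R : realType) (Im x : \bar R) (e : R) : Im < x -> (0 < e)%R ->
  exists y, [/\ Im <= y, y < x & ball x e y].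
Proof.
(* The maximum keeps the point inside the interval, and [e / 2] keeps it strictly within distance
   [e]. *)
move=> Ix e0; pose t := Num.max (contract x - e / 2)%R (contract Im).
have tx : (t < contract x)%R.
  by rewrite gt_max lt_contract Ix andbT ltrBlDr ltrDl divr_gt0.
have It : (contract Im <= t)%R by rewrite le_max lexx orbT.
have t1 : t \in [pred r : R | (`|r| <= 1)%R].
  have /ler_normlP[a1 _] := contract_le1 Im; have /ler_normlP[_ b1] := contract_le1 x.
  rewrite inE ler_norml (le_trans _ It) 1?lerNl//=.
  exact: le_trans (ltW tx) b1.
exists (expand t); split.
- by rewrite le_expandRL.
- by rewrite lt_expandLR.
- rewrite /ball/= /ereal_ball expandK// ger0_norm ?subr_ge0 ?ltW//.
  rewrite ltrBlDl -ltrBlDr (lt_le_trans (y := contract x - e / 2)%R)//.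
    by rewrite ltrD2l ltrN2 ltr_pdivrMr// ltr_pMr// ltr1n.
  by rewrite le_max lexx.
Qed.

Lemma approach_right (R : realType) (Ip x : \bar R) (e : R) : x < Ip ->
  (0 < e)%R -> exists y, [/\ x < y, y <= Ip & ball x e y].
Proof.
move=> xI e0; have [|y [Iy yx xy]] := @approach_left R (- Ip) (- x) e _ e0.
  by rewrite lteN2.
exists (- y); split.
- by rewrite lteNr.
- by rewrite leeNl.
- move: xy; rewrite /ball/= /ereal_ball !contractN.
  by rewrite -opprD normrN opprK.
Qed.

Section differential.
Context (R : realType) (Im Ip : \bar R).
Implicit Types m : {finite_measure set (\bar R) -> \bar R}.
Local Notation mI m := (mrestr m (@measurable_Iopen R Im Ip)).

Lemma measurable_Iclosed : measurable (Iclosed Im Ip).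
Proof.
rewrite (_ : Iclosed _ _ = [set z | Im <= z] `&` [set z | z <= Ip]).
  by apply: measurableI; [exact: emeasurable_ge_set|exact: emeasurable_le_set].
by apply/seteqP; split => z /=; [move=> /andP|move=> [h1 h2]; apply/andP].
Qed.

(** Common form of all four functions: [s] is 1 for $\lambda_+$ and $f_-$, and $-1$ for $\lambda_-$
    and $f_+$. The constant [a], later [F Im], accounts for the endpoint atom that restriction to
    $I$ discards. *)
Lemma affine_cdf_differential m (s a : R) (F : \bar R -> R) :
  (forall x, m [set x] = 0) -> m (~` Iclosed Im Ip) = 0 ->
  (forall x, Iclosed Im Ip x ->
    F x = (a + s * fine (m [set z | (z <= x)%E]))%R) ->
  {within Iclosed Im Ip, continuous F} /\
  is_differential Im Ip F (cscale s (charge_of_finite_measure m)).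
Proof.
move=> atomless supp FE; split.
  apply: (@subspace_eq_continuous _ _ _
      (fun x => a + s * fine (m [set z | (z <= x)%E]))%R).
    by move=> x /set_mem Ix; exact/esym/FE.
  apply: continuous_subspaceT => x.
  apply: cvgD; first exact: cvg_cst.
  by apply: cvgM; [exact: cvg_cst|exact: continuous_cdf].
split.
- move=> A mA AI; rewrite -[LHS]/(s%:E * m A).
  rewrite (_ : m A = 0) ?mule0//; apply: subset_measure0 AI _ => //.
  exact/measurableC/measurable_Iclosed.
- by move=> x; rewrite -[LHS]/(s%:E * m [set x]) atomless mule0.
- move=> x y Ix Iy xy; rewrite -[LHS]/(s%:E * m [set z | x < z <= y]).
  rewrite measure_cdfB// -EFinM !FE//; congr EFin; ring.
Qed.

Lemma measurable_itvcc (x y : \bar R) : measurable [set z | x <= z <= y].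
Proof.
rewrite (_ : mkset _ = [set z | x <= z] `&` [set z | z <= y]).
  by apply: measurableI; [exact: emeasurable_ge_set|exact: emeasurable_le_set].
by apply/seteqP; split => z /=; [move=> /andP|move=> [-> ->]].
Qed.

Lemma measurable_itvco (x y : \bar R) : measurable [set z | x <= z < y].
Proof.
rewrite (_ : mkset _ = [set z | x <= z] `&` [set z | z < y]).
  by apply: measurableI; [exact: emeasurable_ge_set|exact: emeasurable_lt_set].
by apply/seteqP; split => z /=; [move=> /andP|move=> [-> ->]].
Qed.

Lemma measurable_itvoc (x y : \bar R) : measurable [set z | x < z <= y].
Proof.
rewrite (_ : mkset _ = [set z | x < z] `&` [set z | z <= y]).
  by apply: measurableI; [exact: emeasurable_gt_set|exact: emeasurable_le_set].
by apply/seteqP; split => z /=; [move=> /andP|move=> [-> ->]].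
Qed.

#[local] Hint Resolve measurable_itvcc measurable_itvco measurable_itvoc : core.

Lemma Iclosed_Im : Im < Ip -> Iclosed Im Ip Im.
Proof. by move=> /ltW; rewrite /Iclosed/= lexx. Qed.

Lemma IopenW x : Iopen Im Ip x -> Iclosed Im Ip x.
Proof. by move=> /andP[Ix xI]; rewrite /Iclosed/= !ltW. Qed.

Lemma mrestr_atomless m : (forall x, Iopen Im Ip x -> m [set x] = 0) ->
  forall x, mI m [set x] = 0.
Proof.
move=> atomless x; rewrite /mrestr.
have [Ix|nIx] := pselect (Iopen Im Ip x).
  by rewrite setIidl ?atomless// => z ->.
by rewrite (_ : _ `&` _ = set0) ?measure0//; apply/seteqP; split => // z [/= ->].
Qed.

Let mrestr_supp m : mI m (~` Iclosed Im Ip) = 0.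
Proof.
rewrite /mrestr (_ : _ `&` _ = set0) ?measure0//.
by apply/seteqP; split => // z [nI /IopenW].
Qed.

Lemma lower_cdf_differential m (F : \bar R -> R) : Im < Ip ->
  (forall x, Im < x <= Ip -> m [set x] = 0) ->
  (forall x, Iclosed Im Ip x -> m [set z | Im <= z <= x] = (F x)%:E) ->
  {within Iclosed Im Ip, continuous F} /\
  is_differential Im Ip F (cscale 1 (charge_of_finite_measure (mI m))).
Proof.
move=> II atomless FE.
apply: (@affine_cdf_differential (mI m) 1 (F Im)) => //.
  by apply: mrestr_atomless => x /andP[Ix xI]; rewrite atomless// Ix ltW.
  exact: mrestr_supp.
move=> x Ix; apply: EFin_inj; rewrite EFinD mul1r fineK; last first.
  by rewrite fin_num_measure//; exact: emeasurable_le_set.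
rewrite -!FE//; last exact: Iclosed_Im.
rewrite (_ : [set z | Im <= z <= x] =
  [set z | Im <= z <= Im] `|` [set z | Im < z <= x]); last first.
  case/andP: Ix => Ix _; apply/seteqP; split => z /=.
    move=> /andP[Iz zx]; have [zI|zI] := leP z Im; first by left; rewrite Iz.
    by right; rewrite zx.
  by case=> /andP[h1 h2]; [rewrite h1 (le_trans h2 Ix)|rewrite ltW].
rewrite measureU//; last first.
  apply/seteqP; split => // z /= [/andP[_ zI] /andP[Iz _]].
  by have := lt_le_trans Iz zI; rewrite ltxx.
(* The atom at [Im] has been split off as [F Im]; what remains differs from the restriction to $I$
   at most in the null point [Ip]. *)
congr (_ + _); apply: (@eq_measure_mod_null _ _ _ _ _ _ [set Ip]) => //.
- exact: measurableI (emeasurable_le_set _) (@measurable_Iopen _ _ _).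
- by apply: atomless; rewrite II lexx.
- move=> z /= /andP[Iz zx]; have [->|zI] := eqVneq z Ip; [by right|left].
  split => //; rewrite /Iopen/= Iz lt_neqAle zI /=.
  by apply: (le_trans zx); case/andP: Ix.
- by move=> z [/= zx /andP[Iz zI]]; left; rewrite /= Iz.
Qed.

Lemma upper_cdf_differential m (F : \bar R -> R) : Im < Ip ->
  (forall x, Im <= x < Ip -> m [set x] = 0) ->
  (forall x, Iclosed Im Ip x -> m [set z | x <= z <= Ip] = (F x)%:E) ->
  {within Iclosed Im Ip, continuous F} /\
  is_differential Im Ip F (cscale (-1) (charge_of_finite_measure (mI m))).
Proof.
move=> II atomless FE.
apply: (@affine_cdf_differential (mI m) (-1) (F Im)) => //.
  by apply: mrestr_atomless => x /andP[Ix xI]; rewrite atomless// xI ltW.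
  exact: mrestr_supp.
move=> x Ix; apply/eqP; rewrite mulN1r -subr_eq opprK; apply/eqP.
apply: EFin_inj; rewrite EFinD fineK; last first.
  by rewrite fin_num_measure//; exact: emeasurable_le_set.
rewrite -!FE//; last exact: Iclosed_Im.
rewrite (_ : [set z | Im <= z <= Ip] =
  [set z | x <= z <= Ip] `|` [set z | Im <= z < x]); last first.
  case/andP: Ix => Ix xI; apply/seteqP; split => z /=.
    move=> /andP[Iz zI]; have [xz|zx] := leP x z; first by left; rewrite zI.
    by right; rewrite Iz.
  by case=> /andP[h1 h2]; [rewrite (le_trans Ix h1)|rewrite h1 (le_trans (ltW h2) xI)].
rewrite measureU//; last first.
  apply/seteqP; split => // z /= [/andP[xz _] /andP[_ zx]].
  by have := lt_le_trans zx xz; rewrite ltxx.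
congr (_ + _); apply/esym.
(* The point [x] is intersected with $I$ because [x] may be [Ip], where [m] is allowed an atom. *)
apply: (@eq_measure_mod_null _ _ _ _ _ _ ([set Im] `|` ([set x] `&` Iopen Im Ip))).
- exact: measurable_itvco.
- exact: measurableI (emeasurable_le_set _) (@measurable_Iopen _ _ _).
- by apply: measurableU => //; apply: measurableI => //; exact: measurable_Iopen.
- rewrite null_set_setU//; last 2 first.
  + by apply: atomless; rewrite II lexx.
  + apply: (@mrestr_atomless m _ x) => y /andP[Iy yI].
    by apply: atomless; rewrite yI ltW.
  exact: (measurableI _ _ (emeasurable_set1 x) (@measurable_Iopen _ _ _)).
- move=> z /= /andP[Iz zx]; have [->|zI] := eqVneq z Im; [by right; left|left].
  split; first exact: ltW.
  rewrite /Iopen/= lt_neqAle eq_sym zI Iz (lt_le_trans zx)//.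
  by case/andP: Ix.
- move=> z [/= zx Iz]; have [zE|zx'] := eqVneq z x; first by right; right.
  by left; rewrite lt_neqAle zx' zx !andbT; case/andP: Iz => /ltW.
Qed.

Lemma atom0_of_continuous m (F : \bar R -> R) x :
  {within Iclosed Im Ip, continuous F} -> Iclosed Im Ip x ->
  (forall e, (0 < e)%R -> exists y, [/\ Iclosed Im Ip y, ball x e y &
    m [set x] <= `|F x - F y|%:E]) ->
  m [set x] = 0.
Proof.
move=> cF Ix near_x; apply/eqP; rewrite eq_le measure_ge0 andbT.
apply/lee_addgt0Pr => e e0; rewrite add0e.
have /subspace_continuousP/(_ x Ix)/cvgrPdist_lt/(_ _ e0) := cF.
move=> /(@nbhs_ballP R (\bar R))[r /= r0 xr].
have [y [Iy xy mx]] := near_x _ r0.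
by apply: (le_trans mx); rewrite lee_fin ltW//; exact: xr.
Qed.

(** An atom at [x] forces [F] to jump by at least its mass between [x] and every point to its left.
    At [Im] the interval has no such point, so an atom there remains possible. *)
Lemma lower_cdf_atom0 m (F : \bar R -> R) :
  {within Iclosed Im Ip, continuous F} ->
  (forall x, Iclosed Im Ip x -> m [set z | Im <= z <= x] = (F x)%:E) ->
  forall x, Im < x <= Ip -> m [set x] = 0.
Proof.
move=> cF FE x /andP[Ix xI].
apply: (atom0_of_continuous cF); first by rewrite /Iclosed/= ltW.
move=> e e0; have [y [Iy yx xy]] := approach_left Ix e0.
have Iy' : Iclosed Im Ip y by rewrite /Iclosed/= Iy (le_trans (ltW yx)).
have Ix' : Iclosed Im Ip x by rewrite /Iclosed/= (ltW Ix).
exists y; split => //; apply: (@le_trans _ _ (F x - F y)%:E); last first.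
  by rewrite lee_fin ler_norm.
rewrite EFinB leeBrDr// -!FE// -measureU//; last first.
  by apply/seteqP; split => // z [/= -> /andP[_]]; rewrite leNgt yx.
rewrite le_measure ?inE//; first exact: measurableU.
move=> z [/= ->|/= /andP[-> zy]]; first by rewrite (ltW Ix) lexx.
exact: le_trans zy (ltW yx).
Qed.

Lemma upper_cdf_atom0 m (F : \bar R -> R) :
  {within Iclosed Im Ip, continuous F} ->
  (forall x, Iclosed Im Ip x -> m [set z | x <= z <= Ip] = (F x)%:E) ->
  forall x, Im <= x < Ip -> m [set x] = 0.
Proof.
move=> cF FE x /andP[Ix xI].
apply: (atom0_of_continuous cF); first by rewrite /Iclosed/= Ix ltW.
move=> e e0; have [y [xy yI bxy]] := approach_right xI e0.
have Iy' : Iclosed Im Ip y by rewrite /Iclosed/= yI (le_trans Ix (ltW xy)).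
have Ix' : Iclosed Im Ip x by rewrite /Iclosed/= Ix ltW.
exists y; split => //; apply: (@le_trans _ _ (F x - F y)%:E); last first.
  by rewrite lee_fin ler_norm.
rewrite EFinB leeBrDr// -!FE// -measureU//; last first.
  by apply/seteqP; split => // z [/= -> /andP[]]; rewrite leNgt xy.
rewrite le_measure ?inE//; first exact: measurableU.
move=> z [/= ->|/= /andP[yz ->]]; first by rewrite (ltW xI) lexx.
by rewrite (le_trans (ltW xy) yz).
Qed.

End differential.

(** * Luckock's equations *)

Section measure_ray.
Context (R : realType) (m : {finite_measure set (\bar R) -> \bar R}).

Lemma measurable_fun_measure_le :
  measurable_fun setT (fun x : \bar R => m [set z | z <= x]).
Proof.
have mr : measurable [set z : \bar R * \bar R | z.1 <= z.2] by exact: emeasurable_le.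
have := measurable_fun_ysection m mr; congr measurable_fun.
by apply/funext => x /=; rewrite ysectionE.
Qed.

Lemma measurable_fun_measure_ge :
  measurable_fun setT (fun x : \bar R => m [set z | x <= z]).
Proof.
have mr : measurable [set z : \bar R * \bar R | z.1 <= z.2] by exact: emeasurable_le.
have := measurable_fun_xsection m mr; congr measurable_fun.
by apply/funext => x /=; rewrite xsectionE.
Qed.

Lemma integral_point (x : \bar R) (f : \bar R -> \bar R) :
  \int[m]_(y in [set x]) f y = f x * m [set x].
Proof.
rewrite (eq_integral (cst (f x))); first by rewrite integral_cst.
by move=> y /set_mem ->.
Qed.

Lemma integral_le1_fin_num (A : set (\bar R)) (f : \bar R -> \bar R) :
  measurable A -> measurable_fun A f -> (forall x, A x -> 0 <= f x <= 1) ->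
  \int[m]_(x in A) f x \is a fin_num.
Proof.
move=> mA mf f01; rewrite ge0_fin_numE; last first.
  by apply: integral_ge0 => x /f01/andP[].
apply: (@le_lt_trans _ _ (\int[m]_(x in A) cst 1 x)).
  by apply: ge0_le_integral => // x /f01/andP[].
by rewrite integral_cst// mul1e ltey_eq fin_num_measure.
Qed.

End measure_ray.

(** In each equation one differentiated function increases and the other decreases, so the claim is
    that two integrals over $A\cap I$ cancel. Their finiteness excludes $\infty-\infty$. *)
Lemma weighted_sum0 (R : realType) (Im Ip : \bar R)
    (m1 m2 : {finite_measure set (\bar R) -> \bar R})
    (nu1 nu2 : {charge set (\bar R) -> \bar R}) (g1 g2 : \bar R -> R) A :
  (forall B, nu1 B = m1 (B `&` Iopen Im Ip)) ->
  (forall B, nu2 B = - m2 (B `&` Iopen Im Ip)) ->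
  measurable A ->
  measurable_fun A (EFin \o g1) -> measurable_fun A (EFin \o g2) ->
  (forall x, A x -> 0 <= g1 x)%R -> (forall x, A x -> 0 <= g2 x)%R ->
  \int[m1]_(x in A `&` Iopen Im Ip) (g1 x)%:E =
    \int[m2]_(x in A `&` Iopen Im Ip) (g2 x)%:E ->
  \int[m1]_(x in A `&` Iopen Im Ip) (g1 x)%:E \is a fin_num ->
  weighted g1 nu1 A + weighted g2 nu2 A = 0.
Proof.
move=> nu1E nu2E mA mg1 mg2 g10 g20 int12 fin1.
rewrite (@weighted_measure _ _ (mrestr m1 (@measurable_Iopen R Im Ip)))//.
rewrite (@weighted_measureN _ _ (mrestr m2 (@measurable_Iopen R Im Ip)))//.
by rewrite !integral_mrestr// -int12 subee.
Qed.

Section flow.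
Context (R : realType) (Im Ip : \bar R)
  (mum mup : {finite_measure set (\bar R) -> \bar R})
  (mu : {finite_measure set (\bar R * bool)%type -> \bar R})
  (nu : probability (Sord Im Ip) R)
  (d : measure_display) (Omega : measurableType d) (P : probability Omega R)
  (X : nat -> {RV P >-> Sord Im Ip})
  (W : nat -> {RV P >-> (\bar R * bool)%type}).
Hypothesis II : Im < Ip.
Hypothesis muE : forall A, measurable A ->
  mu (A `*` [set false]) = mum A /\ mu (A `*` [set true]) = mup A.
Hypothesis inv : invariant_law mu nu.
Hypothesis XW : stigler_luckock mu X W.
Hypothesis law0 : has_law (X 0%N) nu.
Variable k : nat.

Local Notation Pm := (distribution P
  ((@Mminus R Im Ip : {mfun Sord Im Ip >-> \bar R}) \o X k)).
Local Notation Pp := (distribution P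
  ((@Mplus R Im Ip : {mfun Sord Im Ip >-> \bar R}) \o X k)).

Let c0 : (0 <= (fine (mu setT))^-1)%R.
Proof. by rewrite invr_ge0 fine_ge0// measure_ge0. Qed.

Let c : {nonneg R} := NngNum c0.

(** If the constant were 0, the law of [W 0%N] would have total mass 0. *)
Let c_neq0 : c%:num%:E != 0.
Proof.
have [lawW _ _] := XW; have := lawW 0%N setT measurableT.
rewrite probability_setT /normalized => /eqP; apply: contraTN => /eqP.
by rewrite /c/= => ->; rewrite mul0e eqe oner_eq0.
Qed.

Let cI (x y : \bar R) : c%:num%:E * x = c%:num%:E * y -> x = y.
Proof.
move=> /(congr1 (mule (c%:num^-1)%:E)); rewrite !muleA -EFinM mulVf ?mul1e//.
Qed.

Let lawW (b : bool) B : measurable B -> P (W k @^-1` (B `*` [set b])) =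
  c%:num%:E * (if b then mup else mum) B.
Proof.
move=> mB; have [+ _ _] := XW => /(_ k (B `*` [set b])).
rewrite /distribution/= /pushforward => ->; last exact: measurableX.
by rewrite /normalized; case: b; [rewrite (muE mB).2|rewrite (muE mB).1].
Qed.

Let stat A : measurable A -> distribution P (X k.+1) A = distribution P (X k) A.
Proof.
move=> mA; rewrite (stigler_luckock_stationary XW (k.+1) inv law0)//.
by rewrite (stigler_luckock_stationary XW k inv law0).
Qed.

Let step w : X k.+1 w = luckock (W k w) (X k w).
Proof. by have [_ _ ->] := XW. Qed.

(** The added event is integrated over the book for a fixed price, the removed one over the price
    for a fixed book, so that [A] constrains the outer variable on both sides. The common factor
    $1/|\mu|$ cancels. *)
Lemma sell_flow A : measurable A -> A `<=` Iopen Im Ip ->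
  \int[mup]_(u in A) Pm [set z | z < u] =
  \int[Pp]_(y in A) mum [set u | y <= u].
Proof.
move=> mA AI; have := sell_balance II step stat mA AI.
have mlt : measurable [set z : \bar R * \bar R | z.1 < z.2] by exact: emeasurable_lt.
have mle : measurable [set z : \bar R * \bar R | z.1 <= z.2] by exact: emeasurable_le.
have ind A' B' := @stigler_luckock_indep _ _ _ _ _ _ _ _ _ XW k A' B'.
have := marked_integral_price (@Mminus R Im Ip) ind (lawW true) mlt mA.
rewrite -[X in X = _ -> _]/(P ((fun w => (W k w, X k w)) @^-1` sell_added A)) => ->.
have := marked_integral_state (@Mplus R Im Ip) ind (lawW false) mle mA.
rewrite -[X in X = _ -> _]/(P ((fun w => (W k w, X k w)) @^-1` sell_removed A)) => ->.
move=> /cI h.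
transitivity (\int[mup]_(u in A) Pm (ysection [set z : \bar R * \bar R | z.1 < z.2] u)).
  by apply: eq_integral => u _; rewrite ysectionE.
by rewrite h; apply: eq_integral => y _; rewrite xsectionE.
Qed.

Lemma buy_flow A : measurable A -> A `<=` Iopen Im Ip ->
  \int[mum]_(u in A) Pp [set z | u < z] =
  \int[Pm]_(y in A) mup [set u | u <= y].
Proof.
move=> mA AI; have := buy_balance II step stat mA AI.
have mlt : measurable [set z : \bar R * \bar R | z.2 < z.1] by exact: emeasurable_lt.
have mle : measurable [set z : \bar R * \bar R | z.2 <= z.1] by exact: emeasurable_le.
have ind A' B' := @stigler_luckock_indep _ _ _ _ _ _ _ _ _ XW k A' B'.
have := marked_integral_price (@Mplus R Im Ip) ind (lawW false) mlt mA.
rewrite -[X in X = _ -> _]/(P ((fun w => (W k w, X k w)) @^-1` buy_added A)) => ->.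
have := marked_integral_state (@Mminus R Im Ip) ind (lawW true) mle mA.
rewrite -[X in X = _ -> _]/(P ((fun w => (W k w, X k w)) @^-1` buy_removed A)) => ->.
move=> /cI h.
transitivity (\int[mum]_(u in A) Pp (ysection [set z : \bar R * \bar R | z.2 < z.1] u)).
  by apply: eq_integral => u _; rewrite ysectionE.
by rewrite h; apply: eq_integral => y _; rewrite xsectionE.
Qed.

End flow.

Unset Implicit Arguments.
Set Strict Implicit.

Theorem theorem1 (R : realType) (Im Ip : \bar R) (lm lp : \bar R -> R)
  (mum mup : {finite_measure set (\bar R) -> \bar R})
  (mu : {finite_measure set (\bar R * bool)%type -> \bar R})
  (nu : probability (Sord Im Ip) R)
  (d : measure_display) (Omega : measurableType d) (P : probability Omega R)
  (X : nat -> {RV P >-> Sord Im Ip})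
  (W : nat -> {RV P >-> (\bar R * bool)%type}) :
  Im < Ip ->
  {within Iclosed Im Ip, continuous lm} ->
  {within Iclosed Im Ip, continuous lp} ->
  (forall x, Iclosed Im Ip x -> (0 <= lm x)%R /\ (0 <= lp x)%R) ->
  (forall x y, Iclosed Im Ip x -> Iclosed Im Ip y -> x <= y -> (lm y <= lm x)%R) ->
  (forall x y, Iclosed Im Ip x -> Iclosed Im Ip y -> x <= y -> (lp x <= lp y)%R) ->
  (forall x, Iopen Im Ip x -> (0 < lm x)%R /\ (0 < lp x)%R) ->
  demand_supply_measure Im Ip lm lp mum mup mu ->
  invariant_law mu nu ->
  stigler_luckock mu X W ->
  has_law (X 0%N) nu ->
  forall k : nat,
  let fm := fun x : \bar R => fine (P [set w | Mminus (X k w) <= x]) in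
  let fp := fun x : \bar R => fine (P [set w | x <= Mplus (X k w)]) in
  [/\ {within Iclosed Im Ip, continuous fm},
      {within Iclosed Im Ip, continuous fp},
      (exists dlm dlp dfm dfp : {charge set (\bar R) -> \bar R},
        [/\ is_differential Im Ip lm dlm /\ is_differential Im Ip lp dlp,
            is_differential Im Ip fm dfm /\ is_differential Im Ip fp dfp,
            (forall A, measurable A -> A `<=` Iclosed Im Ip ->
               weighted fm dlp A + weighted lm dfp A = 0) &
            (forall A, measurable A -> A `<=` Iclosed Im Ip ->
               weighted fp dlm A + weighted lp dfm A = 0)]) &
      fm Ip = 1%R /\ fp Im = 1%R].
Proof.
move=> II clm clp lge0 _ _ lgt0 [[mum0 mup0] mumE mupE muE] inv XW law0 k fm fp.
pose MmX := (@Mminus R Im Ip : {mfun Sord Im Ip >-> \bar R}) \o X k.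
pose MpX := (@Mplus R Im Ip : {mfun Sord Im Ip >-> \bar R}) \o X k.
pose Pm : probability (\bar R) R := distribution P MmX.
pose Pp : probability (\bar R) R := distribution P MpX.
have sflow A := @sell_flow _ _ _ _ _ _ _ _ _ _ _ _ II muE inv XW law0 k A.
have bflow A := @buy_flow _ _ _ _ _ _ _ _ _ _ _ _ II muE inv XW law0 k A.
have fmE x : (fm x)%:E = Pm [set z | z <= x].
  rewrite fineK// fin_num_measure//.
  exact: (law_measurable MmX (emeasurable_le_set x)).
have fpE x : (fp x)%:E = Pp [set z | x <= z].
  rewrite fineK// fin_num_measure//.
  exact: (law_measurable MpX (emeasurable_ge_set x)).
have fmE' x : Iclosed Im Ip x -> Pm [set z | Im <= z <= x] = (fm x)%:E.
  move=> _; rewrite fmE; congr (P _); apply/seteqP; split => w /=.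
    by move=> /andP[].
  by move=> ->; rewrite Mminus_ge.
have fpE' x : Iclosed Im Ip x -> Pp [set z | x <= z <= Ip] = (fp x)%:E.
  move=> _; rewrite fpE; congr (P _); apply/seteqP; split => w /=.
    by move=> /andP[].
  by move=> ->; rewrite Mplus_le.
(* The flow equations contain half-lines; they may replace intervals because [mum] has no mass
   outside the closed interval. *)
have lmE x : Iclosed Im Ip x -> (lm x)%:E = mum [set z | x <= z].
  move=> Ix; rewrite -mumE//.
  apply: (@eq_measure_mod_null _ _ _ _ _ _ (~` Iclosed Im Ip)) => //.
  - exact: measurable_itvcc.
  - exact: emeasurable_ge_set.
  - exact/measurableC/measurable_Iclosed.
  - by move=> z /= /andP[xz _]; left.
  - move=> z /= xz; have [Iz|] := pselect (Iclosed Im Ip z); last by right.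
    by left; rewrite xz; case/andP: Iz.
have lpE x : Iclosed Im Ip x -> (lp x)%:E = mup [set z | z <= x].
  move=> Ix; rewrite -mupE//.
  apply: (@eq_measure_mod_null _ _ _ _ _ _ (~` Iclosed Im Ip)) => //.
  - exact: measurable_itvcc.
  - exact: emeasurable_le_set.
  - exact/measurableC/measurable_Iclosed.
  - by move=> z /= /andP[_ xz]; left.
  - move=> z /= xz; have [Iz|] := pselect (Iclosed Im Ip z); last by right.
    by left; rewrite xz andbT; case/andP: Iz.
have mum_atom := upper_cdf_atom0 clm mumE.
have mup_atom := lower_cdf_atom0 clp mupE.
have Pp_atomI x : Iopen Im Ip x -> Pp [set x] = 0.
  move=> Ix; have [Ix1 Ix2] := andP Ix.
  have := sflow [set x]; rewrite !integral_point mup_atom ?Ix1 ?ltW// mule0.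
  rewrite -lmE//; last exact: IopenW.
  move=> /(_ (emeasurable_set1 x)) /(_ (fun y yx => ltac:(by rewrite yx))).
  move=> /esym/eqP; rewrite mule_eq0 eqe gt_eqF/=; last by have [] := lgt0 _ Ix.
  by move=> /eqP.
have Pm_atomI x : Iopen Im Ip x -> Pm [set x] = 0.
  move=> Ix; have [Ix1 Ix2] := andP Ix.
  have := bflow [set x]; rewrite !integral_point mum_atom ?Ix2 ?ltW// mule0.
  rewrite -lpE//; last exact: IopenW.
  move=> /(_ (emeasurable_set1 x)) /(_ (fun y yx => ltac:(by rewrite yx))).
  move=> /esym/eqP; rewrite mule_eq0 eqe gt_eqF/=; last by have [] := lgt0 _ Ix.
  by move=> /eqP.
(* The flow equations see only subsets of $I$. That [Pm] has no atom at [Ip] comes instead from the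
   maximum being attained at [Im] or at a point of $I$. *)
have Mm_lt Y : @Mminus R Im Ip Y < Ip.
  by case: (Mminus_max Y) => [->//|[/andP[]]].
have Mp_gt Y : Im < @Mplus R Im Ip Y.
  by case: (Mplus_min Y) => [->//|[/andP[]]].
have Pm_atom x : Im < x <= Ip -> Pm [set x] = 0.
  move=> /andP[Ix]; rewrite le_eqVlt => /predU1P[->|xI]; last first.
    by apply: Pm_atomI; apply/andP.
  rewrite -[LHS]/(P (MmX @^-1` [set Ip])) (_ : _ @^-1` _ = set0) ?measure0//.
  apply/seteqP; split => // w /= ME; have := Mm_lt (X k w).
  by rewrite -[ltLHS]/(MmX w) ME ltxx.
have Pp_atom x : Im <= x < Ip -> Pp [set x] = 0.
  move=> /andP[]; rewrite le_eqVlt => /predU1P[<- _|Ix xI]; last first.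
    by apply: Pp_atomI; apply/andP.
  rewrite -[LHS]/(P (MpX @^-1` [set Im])) (_ : _ @^-1` _ = set0) ?measure0//.
  apply/seteqP; split => // w /= ME; have := Mp_gt (X k w).
  by rewrite -[ltRHS]/(MpX w) ME ltxx.
have [cfm dfmP] := lower_cdf_differential II Pm_atom fmE'.
have [cfp dfpP] := upper_cdf_differential II Pp_atom fpE'.
have [_ dlmP] := upper_cdf_differential II mum_atom mumE.
have [_ dlpP] := lower_cdf_differential II mup_atom mupE.
have mfm A : measurable A -> measurable_fun A (EFin \o fm).
  move=> mA; apply: (@measurable_funS _ _ _ _ setT) => //.
  rewrite (_ : _ \o _ = fun x => Pm [set z | z <= x]); last exact/funext.
  exact: measurable_fun_measure_le.
have mfp A : measurable A -> measurable_fun A (EFin \o fp).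
  move=> mA; apply: (@measurable_funS _ _ _ _ setT) => //.
  rewrite (_ : _ \o _ = fun x => Pp [set z | x <= z]); last exact/funext.
  exact: measurable_fun_measure_ge.
have mlm A : measurable A -> A `<=` Iclosed Im Ip -> measurable_fun A (EFin \o lm).
  move=> mA AI; apply: (eq_measurable_fun (fun x => mum [set z | x <= z])).
    by move=> x /set_mem/AI/lmE.
  by apply: (@measurable_funS _ _ _ _ setT) => //; exact: measurable_fun_measure_ge.
have mlp A : measurable A -> A `<=` Iclosed Im Ip -> measurable_fun A (EFin \o lp).
  move=> mA AI; apply: (eq_measurable_fun (fun x => mup [set z | z <= x])).
    by move=> x /set_mem/AI/lpE.
  by apply: (@measurable_funS _ _ _ _ setT) => //; exact: measurable_fun_measure_le.
have fm01 x : 0 <= (fm x)%:E <= 1.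
  by rewrite fmE measure_ge0 probability_le1//; exact: emeasurable_le_set.
have fp01 x : 0 <= (fp x)%:E <= 1.
  by rewrite fpE measure_ge0 probability_le1//; exact: emeasurable_ge_set.
have mAI A : measurable A -> measurable (A `&` Iopen Im Ip).
  by move=> mA; apply: measurableI => //; exact: measurable_Iopen.
have key1 A : measurable A -> \int[mup]_(x in A `&` Iopen Im Ip) (fm x)%:E =
    \int[Pp]_(x in A `&` Iopen Im Ip) (lm x)%:E.
  move=> mA; have := sflow (A `&` Iopen Im Ip) (mAI _ mA) (@subIsetr _ _ _).
  move=> flow; transitivity (\int[mup]_(u in A `&` Iopen Im Ip) Pm [set z | z < u]).
    apply: eq_integral => x /set_mem[_ Ix]; rewrite fmE.
    apply: (@eq_measure_mod_null _ _ _ _ _ _ [set x]) => //.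
    + exact: emeasurable_le_set.
    + exact: emeasurable_lt_set.
    + exact: Pm_atomI.
    + by move=> z /=; rewrite le_eqVlt => /predU1P[->|]; [right|left].
    + by move=> z /= /ltW; left.
  rewrite flow; apply: eq_integral => x /set_mem[_ Ix].
  by rewrite lmE//; exact: IopenW.
have key2 A : measurable A -> \int[mum]_(x in A `&` Iopen Im Ip) (fp x)%:E =
    \int[Pm]_(x in A `&` Iopen Im Ip) (lp x)%:E.
  move=> mA; have := bflow (A `&` Iopen Im Ip) (mAI _ mA) (@subIsetr _ _ _).
  move=> flow; transitivity (\int[mum]_(u in A `&` Iopen Im Ip) Pp [set z | u < z]).
    apply: eq_integral => x /set_mem[_ Ix]; rewrite fpE.
    apply: (@eq_measure_mod_null _ _ _ _ _ _ [set x]) => //.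
    + exact: emeasurable_ge_set.
    + exact: emeasurable_gt_set.
    + exact: Pp_atomI.
    + by move=> z /=; rewrite le_eqVlt => /predU1P[->|]; [right|left].
    + by move=> z /= /ltW; left.
  rewrite flow; apply: eq_integral => x /set_mem[_ Ix].
  by rewrite lpE//; exact: IopenW.
split => //; last first.
  split; apply: EFin_inj.
    rewrite fmE -(probability_setT Pm); congr (P _).
    by apply/seteqP; split => // w _ /=; exact/ltW/Mm_lt.
  rewrite fpE -(probability_setT Pp); congr (P _).
  by apply/seteqP; split => // w _ /=; exact/ltW/Mp_gt.
(* The four charges are fixed by the next four goals: [mum] with a minus sign, [mup], [Pm], and [Pp]
   with a minus sign, each restricted to $I$. *)
eexists; eexists; eexists; eexists; split; [split|split| |].
- exact: dlmP.
- exact: dlpP.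
- exact: dfmP.
- exact: dfpP.
- move=> A mA AI; apply: (@weighted_sum0 _ Im Ip mup Pp) => //.
  + by move=> B; rewrite -[LHS]/(1%:E * _) mul1e.
  + by move=> B; rewrite -[LHS]/((-1)%:E * _) mulN1e.
  + exact: mfm.
  + exact: mlm.
  + by move=> x _; rewrite -lee_fin; case/andP: (fm01 x).
  + by move=> x /AI/lge0[].
  + exact: key1.
  + by apply: integral_le1_fin_num => //; [exact: mAI|exact/mfm/mAI].
(* In (ii) the increasing function is $f_-$, whose term comes second; the swap puts the positive
   charge first. *)
- move=> A mA AI; rewrite addeC; apply: (@weighted_sum0 _ Im Ip Pm mum) => //.
  + by move=> B; rewrite -[LHS]/(1%:E * _) mul1e.
  + by move=> B; rewrite -[LHS]/((-1)%:E * _) mulN1e.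
  + exact: mlp.
  + exact: mfp.
  + by move=> x /AI/lge0[].
  + by move=> x _; rewrite -lee_fin; case/andP: (fp01 x).
  + by rewrite key2.
  (* Finiteness is read off on the other side of the balance, where the integrand $f_+$ is at most
     1. *)
  + rewrite -key2//.
    by apply: integral_le1_fin_num => //; [exact: mAI|exact/mfp/mAI].
Qed.
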